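(* Let $E$ be a $W^*$-correspondence over a von Neumann algebra $M$, with left action $\varphi$, and let $\sigma:M\to B(H)$ be a normal representation of $M$ on a Hilbert space $H$. Let $$E^\sigma=\{T\in B(H,E\otimes_\sigma H)\mid T\sigma(a)=(\varphi(a)\otimes I_H)T,\ a\in M\}.$$ For $X,Y\in\sigma(M)'$ and $T\in E^\sigma$ put $X\cdot T\cdot Y:=(I_E\otimes X)TY$, and for $T,S\in E^\sigma$ put $\langle T,S\rangle_{\sigma(M)'}:=T^*S$. With respect to these actions of $\sigma(M)'$ and this $\sigma(M)'$-valued inner product, $E^\sigma$ is a $W^*$-correspondence over $\sigma(M)'$.
   Context: Conventions: Hilbert space and module-valued inner products are linear in the second variable; representations and left actions are unital. A $W^{*}$-correspondence $E$ over a von Neumann algebra $M$ is a self-dual right Hilbert $C^*$-module over $M$ (every bounded right-module map $E\to M$ has the form $\langle\eta,\cdot\rangle$ for some $\eta\in E$) made into a left $M$-module by a normal $*$-homomorphism $\varphi:M\to\mathcal{L}(E)$, where $\mathcal{L}(E)$ is the $W^*$-algebra of bounded (adjointable) module maps on $E$. $E\otimes_\sigma H$ is the Hausdorff completion of the algebraic tensor product in $\langle\xi\otimes h,\eta\otimes k\rangle=\langle h,\sigma(\langle\xi,\eta\rangle)k\rangle$. For $X\in\sigma(M)'$, $I_E\otimes X$ is the bounded operator $\xi\otimes h\mapsto\xi\otimes Xh$ on $E\otimes_\sigma H$. *)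

(* Defs.v *)
From HB Require Import structures.
From mathcomp Require Import all_boot all_order all_algebra complex.
From mathcomp Require Import all_classical all_reals topology normedtype.
Set Implicit Arguments.
Unset Strict Implicit.
Unset Printing Implicit Defensive.
Import Order.TTheory GRing.Theory Num.Theory.
Import numFieldNormedType.Exports.
Local Open Scope classical_set_scope.
Local Open Scope ring_scope.
Local Open Scope complex_scope.

(* Complex Hilbert spaces: the inner product is linear in the second variable.
   The norm of a normedModType over R[i] takes values in R[i]. *)
HB.mixin Record CompleteNormedModule_isHilbert (R : realType) V
    of CompleteNormedModule R[i] V := {
  hdot : V -> V -> R[i] ;
  hdot_linear : forall x : V, scalar (hdot x) ;
  hdot_conj : forall x y : V, hdot y x = (hdot x y)^* ;
  hdot_norm : forall x : V, hdot x x = `|x| ^+ 2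
}.

#[short(type="hilbertType")]
HB.structure Definition Hilbert (R : realType) :=
  {V of CompleteNormedModule R[i] V & CompleteNormedModule_isHilbert R V}.

(* Operators are plain functions, with pointwise linear structure; B(H,K) is
   the subset bounded_op of H -> K. *)
Section Operators.
Context {R : realType}.

Definition bounded_op {H K : hilbertType R} (T : H -> K) : Prop :=
  linear T /\ exists c : R, forall x, `|T x| <= c%:C * `|x|.

Definition opnorm {H K : hilbertType R} (T : H -> K) : R :=
  sup [set complex.Re `|T x| | x in [set x : H | `|x| <= 1]].

(* The default value 0 is irrelevant: a bounded operator has one adjoint. *)
Definition adj {H K : hilbertType R} (T : H -> K) : K -> H :=
  xget 0 [set S : K -> H |
           bounded_op S /\ forall x y, hdot (T x) y = hdot x (S y)].

(* In R[i], 0 <= z means that z is real and nonnegative. *)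
Definition positive_op {H : hilbertType R} (T : H -> H) : Prop :=
  forall x, 0 <= hdot x (T x).

Definition op_le {H : hilbertType R} (S T : H -> H) : Prop :=
  forall x, hdot x (S x) <= hdot x (T x).

Definition commutant {H : hilbertType R} (A : set (H -> H)) : set (H -> H) :=
  [set T | bounded_op T /\ forall S, A S -> T \o S = S \o T].

(* Commutants are unital algebras, so the last condition makes M one too. *)
Definition von_neumann_algebra {H : hilbertType R} (M : set (H -> H)) : Prop :=
  [/\ M `<=` bounded_op,
      forall S, M S -> M (adj S)
    & commutant (commutant M) = M].

Definition selfadjoint_part {H : hilbertType R} (M : set (H -> H)) :
    set (H -> H) :=
  [set S | M S /\ adj S = S].

End Operators.

Section Normality.

Definition directed_by {U : Type} (le : U -> U -> Prop) (D : set U) : Prop :=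
  D !=set0 /\
  forall x y, D x -> D y -> exists z, [/\ D z, le x z & le y z].

Definition lub_in {U : Type} (A : set U) (le : U -> U -> Prop)
    (D : set U) (s : U) : Prop :=
  [/\ A s, forall d, D d -> le d s
    & forall u, A u -> (forall d, D d -> le d u) -> le s u].

(* f preserves suprema of increasing nets that are bounded above; in a von
   Neumann algebra these always have a supremum.  A and B are the self-adjoint
   parts of the source and of the target. *)
Definition normal_map {U V : Type} (A : set U) (leA : U -> U -> Prop)
    (B : set V) (leB : V -> V -> Prop) (f : U -> V) : Prop :=
  forall D s, D `<=` A -> directed_by leA D -> lub_in A leA D s ->
    lub_in B leB (f @` D) (f s).

End Normality.

Section Representations.
Context {R : realType} {K H : hilbertType R}.

(* Only the values of sigma on M matter. *)
Record normal_representation (M : set (K -> K))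
    (sigma : (K -> K) -> (H -> H)) : Prop := NormalRepresentation {
  rep_bounded : forall a, M a -> bounded_op (sigma a) ;
  rep_linear : forall (c : R[i]) a b, M a -> M b ->
    sigma (c *: a + b) = c *: sigma a + sigma b ;
  rep_mul : forall a b, M a -> M b -> sigma (a \o b) = sigma a \o sigma b ;
  rep_adj : forall a, M a -> sigma (adj a) = adj (sigma a) ;
  rep_unit : sigma id = id ;
  rep_normal : normal_map (selfadjoint_part M) op_le
    (selfadjoint_part bounded_op) op_le sigma
}.

End Representations.

(* The carrier of a module is a linear subspace X of an ambient vector space E;
   M acts on the right through act, and phi is the left action.  Only the
   values of act, ip and phi on X and M matter, and maps X -> X are represented
   by maps E -> E, identified when they agree on X. *)
Section Modules.
Context {R : realType} {K : hilbertType R} {E : lmodType R[i]}.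
Variables (M : set (K -> K)) (X : set E).
Variables (act : E -> (K -> K) -> E) (ip : E -> E -> (K -> K)).

Definition module_norm (x : E) : R := Num.sqrt (opnorm (ip x x)).

Record hilbert_module : Prop := HilbertModule {
  hm_0 : X 0 ;
  hm_lin : forall (c : R[i]) x y, X x -> X y -> X (c *: x + y) ;
  hm_act : forall x a, X x -> M a -> X (act x a) ;
  hm_actDl : forall (c : R[i]) x y a, X x -> X y -> M a ->
    act (c *: x + y) a = c *: act x a + act y a ;
  hm_actDr : forall (c : R[i]) x a b, X x -> M a -> M b ->
    act x (c *: a + b) = c *: act x a + act x b ;
  hm_actM : forall x a b, X x -> M a -> M b -> act x (a \o b) = act (act x a) b ;
  hm_act1 : forall x, X x -> act x id = x ;
  hm_ip : forall x y, X x -> X y -> M (ip x y) ;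
  hm_ipDr : forall (c : R[i]) x y z, X x -> X y -> X z ->
    ip x (c *: y + z) = c *: ip x y + ip x z ;
  hm_ipM : forall x y a, X x -> X y -> M a -> ip x (act y a) = ip x y \o a ;
  hm_ip_adj : forall x y, X x -> X y -> ip y x = adj (ip x y) ;
  hm_ip_ge0 : forall x, X x -> positive_op (ip x x) ;
  hm_ip_eq0 : forall x, X x -> ip x x = 0 -> x = 0 ;
  hm_complete : forall u : nat -> E, (forall n, X (u n)) ->
    (forall e : R, 0 < e -> exists N : nat, forall m n : nat,
       (N <= m)%N -> (N <= n)%N -> module_norm (u m - u n) < e) ->
    exists2 x, X x & forall e : R, 0 < e -> exists N : nat, forall n : nat,
       (N <= n)%N -> module_norm (u n - x) < e
}.

Definition self_dual : Prop :=
  forall F : E -> (K -> K),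
    (forall x, X x -> M (F x)) ->
    (forall (c : R[i]) x y, X x -> X y -> F (c *: x + y) = c *: F x + F y) ->
    (forall x a, X x -> M a -> F (act x a) = F x \o a) ->
    (exists c : R, forall x, X x -> opnorm (F x) <= c * module_norm x) ->
    exists2 y, X y & forall x, X x -> F x = ip y x.

Record bounded_module_map (T : E -> E) : Prop := BoundedModuleMap {
  bmm_in : forall x, X x -> X (T x) ;
  bmm_lin : forall (c : R[i]) x y, X x -> X y ->
    T (c *: x + y) = c *: T x + T y ;
  bmm_act : forall x a, X x -> M a -> T (act x a) = act (T x) a ;
  bmm_bounded : exists c : R, forall x, X x ->
    module_norm (T x) <= c * module_norm x
}.

Definition adjoint_maps (T S : E -> E) : Prop :=
  forall x y, X x -> X y -> ip (T x) y = ip x (S y).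

(* the W*-algebra L(E) *)
Definition adjointable : set (E -> E) :=
  [set T | bounded_module_map T /\
           exists2 S, bounded_module_map S & adjoint_maps T S].

Definition adjointable_le (S T : E -> E) : Prop :=
  forall x, X x -> positive_op (ip x (T x - S x)).

Record normal_left_action (phi : (K -> K) -> (E -> E)) : Prop :=
    NormalLeftAction {
  la_adjointable : forall a, M a -> adjointable (phi a) ;
  la_linear : forall (c : R[i]) a b x, M a -> M b -> X x ->
    phi (c *: a + b) x = c *: phi a x + phi b x ;
  la_mul : forall a b x, M a -> M b -> X x -> phi (a \o b) x = phi a (phi b x) ;
  la_adj : forall a, M a -> adjoint_maps (phi a) (phi (adj a)) ;
  la_unit : forall x, X x -> phi id x = x ;
  la_normal : normal_map (selfadjoint_part M) op_le
    [set T | adjointable T /\ adjoint_maps T T] adjointable_le phi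
}.

Record wstar_correspondence (phi : (K -> K) -> (E -> E)) : Prop :=
    WstarCorrespondence {
  wc_algebra : von_neumann_algebra M ;
  wc_module : hilbert_module ;
  wc_self_dual : self_dual ;
  wc_left : normal_left_action phi
}.

End Modules.

Section InteriorTensor.
Context {R : realType} {K H G : hilbertType R} {E : lmodType R[i]}.

(* (G, t) is a Hausdorff completion of the algebraic tensor product of E and H:
   G is complete, and t induces a linear map from the algebraic tensor product
   to G that carries the semi-inner product to that of G and has dense range.
   This determines (G, t) up to a unique unitary. *)
Record interior_tensor (ip : E -> E -> (K -> K))
    (sigma : (K -> K) -> (H -> H)) (t : E -> H -> G) : Prop :=
    InteriorTensor {
  it_linearl : forall h, linear (t^~ h) ;
  it_linearr : forall x, linear (t x) ;
  it_dot : forall x y h k,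
    hdot (t x h) (t y k) = hdot h (sigma (ip x y) k) ;
  it_dense : dense
    [set \sum_(p <- s) t p.1 p.2 | s in [set: seq (E * H)]]
}.

(* A (x) B, the bounded operator with x (x) h |-> A x (x) B h; it is unique
   when it exists, by density. *)
Definition tensor_op (t : E -> H -> G) (A : E -> E) (B : H -> H) : G -> G :=
  xget 0 [set T | bounded_op T /\ forall x h, T (t x h) = t (A x) (B h)].

Definition sigma_dual (M : set (K -> K)) (phi : (K -> K) -> (E -> E))
    (sigma : (K -> K) -> (H -> H)) (t : E -> H -> G) : set (H -> G) :=
  [set T | bounded_op T /\
    forall a, M a -> T \o sigma a = tensor_op t (phi a) id \o T].

End InteriorTensor.

(* Main.v *)
(* Every bounded linear functional on a subspace of a Hilbert space is represented
   by a vector in the closure of that subspace.  Applied to linear relations, this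
   gives adjoints, inverses of coercive operators and extensions of densely
   defined maps.

   The operators phi(a) (x) I and I (x) X are bounded because a symmetric map S
   on an inner product space with |S^n v| <= C_v r^n for all n satisfies
   |S v| <= r |v|: the sequence |S^n v| is logarithmically convex.  The only
   consequence of the normality of sigma that is used is positivity.

   Self-duality: if F is a bounded module functional, T_1, ..., T_n are in the
   dual and d > 0, put W = (d^2 + sum T_i T_i^* )^-1 sum T_i F(T_i)^*.  Then
   F(T_i)^* = T_i^* W + d^2 Z_i with Z_i in the commutant and
   F(W) = W^* W + d^2 sum Z_i^* Z_i, so that the boundedness of F yields
   |W| <= |F| and, as d -> 0, |sum F(T_i) h_i| <= |F| |sum T_i h_i|.  Riesz
   representation of sum T_i h_i |-> <k, sum F(T_i) h_i> then gives the vector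
   y k with F(T) = y^* T.

   Normality of the left action: the supremum of a bounded directed set in the
   commutant is its strong limit, and I (x) - is positive and contractive, so
   strong convergence carries over to the tensor product by density. *)

Require Import Defs.
From mathcomp Require Import all_boot all_order all_algebra complex.
From mathcomp Require Import all_classical all_reals topology normedtype.
From mathcomp Require Import ring lra zify.
Set Implicit Arguments.
Unset Strict Implicit.
Unset Printing Implicit Defensive.
Import Order.TTheory GRing.Theory Num.Theory.
Import numFieldNormedType.Exports.
Local Open Scope classical_set_scope.
Local Open Scope ring_scope.

(** * Real-valued norms and inner products on a complex Hilbert space *)

Section RealInnerProduct.
Local Open Scope complex_scope.
Context {R : realType} {V : hilbertType R}.
Implicit Types (x y z : V) (a b : R) (c : R[i]).

(** Norms and inner products take values in [R[i]], whose order is only partial; estimates are made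
    over [R] with [nrm] and [rdot]. *)
Definition nrm x : R := complex.Re `|x|.
Definition rdot x y : R := complex.Re (hdot x y).

Lemma nrmE x : `|x| = (nrm x)%:C.
Proof. by rewrite /nrm RRe_real // realE normr_ge0. Qed.

Lemma nrm_ge0 x : 0 <= nrm x.
Proof. by rewrite -lecR -nrmE normr_ge0. Qed.

Lemma nrm_eq0 x : nrm x = 0 -> x = 0.
Proof. by move=> h; apply/eqP; rewrite -normr_eq0 nrmE h. Qed.

Lemma nrm0 : nrm 0 = 0.
Proof. by rewrite /nrm normr0. Qed.

Lemma nrmD x y : nrm (x + y) <= nrm x + nrm y.
Proof. by rewrite -lecR rmorphD /= -!nrmE ler_normD. Qed.

Lemma nrmN x : nrm (- x) = nrm x.
Proof. by rewrite /nrm normrN. Qed.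

Lemma nrmB x y : nrm (x - y) = nrm (y - x).
Proof. by rewrite -nrmN opprB. Qed.

Lemma nrmZ c x : nrm (c *: x) = complex.Re `|c| * nrm x.
Proof.
apply: complexI; rewrite -nrmE normrZ nrmE rmorphM /= RRe_real //.
by rewrite realE normr_ge0.
Qed.

Lemma nrmZr a x : 0 <= a -> nrm (a%:C *: x) = a * nrm x.
Proof. by move=> a0; rewrite nrmZ ger0_norm ?lecR. Qed.

Lemma hdotDr x y z : hdot x (y + z) = hdot x y + hdot x z.
Proof. by have := hdot_linear x 1 y z; rewrite scale1r => -> /=; rewrite mul1r. Qed.

Lemma hdot0r x : hdot x 0 = 0.
Proof. by apply: (addrI (hdot x 0)); rewrite -hdotDr !addr0. Qed.

Lemma hdotZr c x y : hdot x (c *: y) = c * hdot x y.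
Proof. by have := hdot_linear x c y 0; rewrite !addr0 hdot0r => -> /=; rewrite addr0. Qed.

Lemma hdotDl x y z : hdot (x + y) z = hdot x z + hdot y z.
Proof. by rewrite hdot_conj hdotDr rmorphD /= -!hdot_conj. Qed.

Lemma hdotZl c x y : hdot (c *: x) y = c^* * hdot x y.
Proof. by rewrite hdot_conj hdotZr rmorphM /= -!hdot_conj. Qed.

Lemma rdotC x y : rdot x y = rdot y x.
Proof. by rewrite /rdot (hdot_conj y x); case: (hdot y x). Qed.

Lemma rdotDr x y z : rdot x (y + z) = rdot x y + rdot x z.
Proof. by rewrite /rdot hdotDr raddfD. Qed.

Lemma rdotZr a x y : rdot x (a%:C *: y) = a * rdot x y.
Proof. by rewrite /rdot hdotZr; case: (hdot x y) => u v /=; rewrite mul0r subr0. Qed.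

Lemma rdotNr x y : rdot x (- y) = - rdot x y.
Proof. by rewrite -scaleN1r -[- 1](_ : (- 1)%:C = _) ?rdotZr ?mulN1r // rmorphN1. Qed.

Lemma rdotBr x y z : rdot x (y - z) = rdot x y - rdot x z.
Proof. by rewrite rdotDr rdotNr. Qed.

Lemma rdotDl x y z : rdot (x + y) z = rdot x z + rdot y z.
Proof. by rewrite rdotC rdotDr !(rdotC z). Qed.

Lemma rdotNl x y : rdot (- x) y = - rdot x y.
Proof. by rewrite rdotC rdotNr rdotC. Qed.

Lemma rdotBl x y z : rdot (x - y) z = rdot x z - rdot y z.
Proof. by rewrite rdotDl rdotNl. Qed.

Lemma rdotZl a x y : rdot (a%:C *: x) y = a * rdot x y.
Proof. by rewrite rdotC rdotZr rdotC. Qed.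

Lemma rdot0r x : rdot x 0 = 0.
Proof. by rewrite /rdot hdot0r. Qed.

Lemma rdot0l x : rdot 0 x = 0.
Proof. by rewrite rdotC rdot0r. Qed.

Lemma rdot_sumr (I : Type) (s : seq I) (f : I -> V) x :
  rdot x (\sum_(i <- s) f i) = \sum_(i <- s) rdot x (f i).
Proof. by elim/big_rec2: _ => [|i u v _ <-]; rewrite ?rdot0r ?rdotDr. Qed.

Lemma rdotxx x : rdot x x = nrm x ^+ 2.
Proof. by rewrite /rdot hdot_norm nrmE -rmorphXn. Qed.

Lemma nrm_sum (I : Type) (s : seq I) (f : I -> V) :
  nrm (\sum_(i <- s) f i) <= \sum_(i <- s) nrm (f i).
Proof.
by elim/big_rec2: _ => [|i u v _ h]; rewrite ?nrm0 // (le_trans (nrmD _ _)) ?lerD2l.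
Qed.

(** Cauchy-Schwarz: expand the squared norm of |y| x - |x| y and divide by 2 |x| |y|; vectors of
    norm zero are treated apart. *)
Lemma rdot_le x y : rdot x y <= nrm x * nrm y.
Proof.
have [->|y0] := eqVneq y 0; first by rewrite rdot0r nrm0 mulr0.
have ny : 0 < nrm y.
  by rewrite lt_neqAle nrm_ge0 andbT eq_sym; apply: contra_neq y0 => /nrm_eq0.
have [nx|nx] := eqVneq (nrm x) 0.
  by rewrite (nrm_eq0 nx) rdot0l nrm0 mul0r.
have nx0 : 0 < nrm x by rewrite lt_neqAle nrm_ge0 andbT eq_sym.
have := sqr_ge0 (nrm ((nrm y)%:C *: x - (nrm x)%:C *: y)).
rewrite -rdotxx !(rdotBl, rdotBr, rdotZl, rdotZr) !rdotxx (rdotC y x) => h.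
have {}h : 0 <= 2 * (nrm x * nrm y) * (nrm x * nrm y - rdot x y) by nra.
by rewrite -subr_ge0; rewrite pmulr_rge0 // in h; rewrite !mulr_gt0.
Qed.

Lemma rdot_norm_le x y : `|rdot x y| <= nrm x * nrm y.
Proof. by rewrite ler_norml rdot_le lerNl -rdotNl -[nrm x]nrmN rdot_le. Qed.

Lemma rdot_ext x y : (forall z, rdot x z = rdot y z) -> x = y.
Proof.
move=> h; apply/eqP; rewrite -subr_eq0; apply/eqP/nrm_eq0.
by apply/eqP; rewrite -sqrf_eq0 -rdotxx rdotBl h subrr.
Qed.

Lemma hdot_ext x y : (forall z, hdot x z = hdot y z) -> x = y.
Proof. by move=> h; apply: rdot_ext => z; rewrite /rdot h. Qed.

End RealInnerProduct.

(** * Limits in epsilon form and completeness *)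

Section Convergence.
Context {R : realType}.

Lemma Re_norm_ge0 (c : R[i]) : 0 <= complex.Re `|c|.
Proof. by have := normr_ge0 c; rewrite lecE => /andP[]. Qed.

(** The multiple [c = 'i] recovers the imaginary part, so complex identities reduce to real ones
    known for all multiples of [y]. *)
Lemma rdot_hdot (V W : hilbertType R) (x y : V) (x' y' : W) :
  (forall c : R[i], rdot x (c *: y) = rdot x' (c *: y')) ->
  hdot x y = hdot x' y'.
Proof.
move=> h; apply/eqP; rewrite eq_complex; apply/andP; split; apply/eqP.
  by have := h 1; rewrite !scale1r.
have := h 'i%C; rewrite /rdot !hdotZr ![_ * hdot _ _]mulrC !ReiNIm.
exact: oppr_inj.
Qed.

Lemma ler_eps (a b : R) : (forall e, 0 < e -> a <= b + e) -> a <= b.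
Proof. by move=> h; apply/ler_addgt0Pr. Qed.

Lemma ler_epsM (a b k : R) :
  0 <= k -> (forall e, 0 < e -> a <= b + k * e) -> a <= b.
Proof.
move=> k0 h; apply: ler_eps => e e0; have k1 : 0 < k + 1 by rewrite ltr_wpDl.
apply: le_trans (h (e / (k + 1)) _) _; first by rewrite divr_gt0.
rewrite lerD2l mulrA ler_pdivrMr // mulrC ler_pM2l //.
by rewrite lerDl.
Qed.

(** Each single [f i] is at most [k]. This is cruder than Cauchy-Schwarz, but the bound is later
    multiplied by a factor tending to 0. *)
Lemma sum_mul_le (I : Type) (s : seq I) (f g : I -> R) (k : R) : 0 <= k ->
  (forall i, 0 <= f i) -> (forall i, 0 <= g i) ->
  \sum_(i <- s) f i ^+ 2 <= k ^+ 2 ->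
  \sum_(i <- s) f i * g i <= k * \sum_(i <- s) g i.
Proof.
move=> k0 f0 g0; elim: s => [|i s IH]; first by rewrite !big_nil mulr0.
rewrite !big_cons mulrDr => h.
have s0 : 0 <= \sum_(j <- s) f j ^+ 2 by apply: sumr_ge0 => j _; exact: sqr_ge0.
apply: lerD; last by apply: IH; have := sqr_ge0 (f i); lra.
rewrite ler_wpM2r // -(@ler_pXn2r _ 2) ?nnegrE //; lra.
Qed.

(* Cantor's intersection theorem, with a limit point of sets that need not be closed. *)
Lemma complete_nested (V : hilbertType R) (B : R -> set V) :
  (forall e, 0 < e -> B e !=set0) ->
  (forall e e', 0 < e -> e <= e' -> B e `<=` B e') ->
  (forall e x y, 0 < e -> B e x -> B e y -> nrm (x - y) <= e) ->
  exists w, forall e x, 0 < e -> B e x -> nrm (x - w) <= e.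
Proof.
move=> B0 Bm Bd.
pose F : set_system V := filter_from [set e : R | 0 < e] B.
have FF : ProperFilter F.
  apply: filter_from_proper => //; apply: filter_from_filter.
    by exists 1 => /=.
  move=> e e' /= e0 e'0; exists (Num.min e e'); first by rewrite /= lt_min e0.
  move=> x Bx; split; apply: Bm Bx; rewrite ?lt_min ?e0 ?e'0 //.
    by rewrite ge_min lexx.
  by rewrite ge_min lexx orbT.
have cF : cauchy F.
  apply: cauchy_exP => e; rewrite ltcE /= => /andP[/eqP ime ree].
  (* A positive [e] in [R[i]] is real; halving it turns the weak diameter bound into a strict
     one. *)
  have e0 : 0 < complex.Re e / 2 by rewrite divr_gt0.
  have [x Bx] := B0 _ e0.
  exists x, (complex.Re e / 2) => //= y By.
  rewrite -ball_normE /ball_ /= nrmE ltcE /= ime eqxx /=.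
  by apply: le_lt_trans (Bd _ _ _ e0 Bx By) _; rewrite ltr_pdivrMr // ltr_pMr // ltr1n.
have [w Fw] := iffLR (cvg_ex F) (cauchy_cvg F cF).
exists w => e x e0 Bx; apply: ler_eps => d d0.
have /Fw [r r0 Br] : nbhs w (ball w (d%:C%C)).
  by apply: nbhsx_ballx; rewrite ltcR.
have rr0 : 0 < Num.min r e by rewrite lt_min r0.
have [y By] := B0 _ rr0.
have /Br : B r y by apply: Bm By => //; by rewrite ge_min lexx.
rewrite -ball_normE /ball_ /= nrmE ltcR => wy.
have Bey : B e y by apply: Bm By => //; by rewrite ge_min lexx orbT.
rewrite -(subrKA y); apply: le_trans (nrmD _ _) _; apply: lerD.
  exact: Bd Bey.
by rewrite nrmB ltW.
Qed.

End Convergence.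

(** * Riesz representation for bounded linear relations *)

Section Riesz.
Local Open Scope complex_scope.
Context {R : realType}.

(** Near 0 a nonzero linear term outweighs the quadratic one; the test point - a / (|b| + 1) already
    forces a = 0. *)
Lemma quadratic_ge0 (a b : R) : (forall s, 0 <= 2 * s * a + s ^+ 2 * b) -> a = 0.
Proof.
move=> h.
have := h (a / (`|b| + 1)); have := h (- a / (`|b| + 1)).
have b0 : 0 < `|b| + 1 by rewrite ltr_wpDl.
have hb : b <= `|b| by rewrite ler_norm.
set s := a / _; rewrite mulNr -/s => h1 h2.
have as_ : a = s * (`|b| + 1) by rewrite /s divfK ?gt_eqF.
move: h1; rewrite as_ => h1.
have s0 : s ^+ 2 <= 0 by nra.
have /eqP : s ^+ 2 = 0 by apply/le_anti; rewrite s0 sqr_ge0.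
by rewrite sqrf_eq0 => /eqP ->; rewrite mul0r.
Qed.

(** Relations allow a map on a subspace to be given by representatives, such as finite sums of
    tensors; its single-valuedness then comes from a norm bound. *)
Definition linear_relation {V W : hilbertType R} (L : V -> W -> Prop) :=
  L 0 0 /\ forall (c : R[i]) v v' w w', L v w -> L v' w' ->
    L (c *: v + v') (c *: w + w').

(* Riesz representation on a subspace that need not be closed: the minimizers
   of |v|^2 - 2 Re <k, w> over the pairs (v, w) of L converge to u. *)
Lemma relation_riesz (V W : hilbertType R) (L : V -> W -> Prop) (C : R) (k : W) :
  linear_relation L -> (forall v w, L v w -> nrm w <= C * nrm v) ->
  exists u, (forall v w, L v w -> hdot u v = hdot k w) /\
    forall e, 0 < e -> exists v w, L v w /\ nrm (v - u) <= e.
Proof.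
move=> [L0 Llin] LC.
have LD v v' w w' : L v w -> L v' w' -> L (v + v') (w + w').
  by move=> h h'; have := Llin 1 _ _ _ _ h h'; rewrite !scale1r.
have LZ c v w : L v w -> L (c *: v) (c *: w).
  by move=> h; have := Llin c _ _ _ _ h L0; rewrite !addr0.
pose q (v : V) (w : W) : R := nrm v ^+ 2 - 2 * rdot k w.
pose S : set R := [set r | exists v w, L v w /\ r = q v w].
have S0 : S !=set0 by exists (q 0 0), 0, 0.
have lS : has_lbound S.
  (* From |w| <= C |v|, by completing the square in |v|. *)
  exists (- (nrm k * C) ^+ 2) => _ [v [w [Lvw ->]]].
  have h1 := rdot_le k w.
  have h2 : nrm k * nrm w <= nrm k * (C * nrm v) by rewrite ler_wpM2l ?nrm_ge0 ?LC.
  have := sqr_ge0 (nrm v - nrm k * C).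
  rewrite /q; nra.
pose m := inf S.
have mq v w : L v w -> m <= q v w by move=> Lvw; apply: ge_inf => //; exists v, w.
pose B e : set V := [set v | exists w, L v w /\ q v w <= m + e ^+ 2 / 4].
have [u Bu] : exists u, forall e v, 0 < e -> B e v -> nrm (v - u) <= e.
  apply: complete_nested.
  - move=> e e0; have e4 : 0 < e ^+ 2 / 4 by rewrite divr_gt0 ?exprn_gt0.
    have [|_ [v [w [Lvw ->]]] /ltW qm] := @inf_adherent _ S _ e4; first by split.
    by exists v, w.
  - move=> e e' e0 ee v [w [Lvw qm]]; exists w; split=> //.
    apply: le_trans qm _; rewrite lerD2l ler_pM2r ?invr_gt0 //.
    by rewrite lerXn2r // nnegrE ?ltW // (lt_le_trans e0 ee).
  - move=> e v v' e0 [w [Lvw qm]] [w' [Lvw' qm']].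
    (* Parallelogram identity: [q] is at least [m] at the midpoint, so two near-minimizers are at
       distance at most [e]. *)
    have := mq _ _ (LZ (2^-1)%:C _ _ (LD _ _ _ _ Lvw Lvw')).
    move: qm qm'; rewrite /q -!rdotxx !(rdotZr, rdotZl) !rdotDr !rdotDl (rdotC v' v).
    move=> qm qm' qmm.
    rewrite -(@ler_pXn2r _ 2) ?nnegrE ?nrm_ge0 ?(ltW e0) //.
    rewrite -rdotxx !(rdotBl, rdotBr) (rdotC v' v).
    by lra.
exists u; split; last first.
  move=> e e0; have e4 : 0 < e ^+ 2 / 4 by rewrite divr_gt0 ?exprn_gt0.
  have [|_ [v [w [Lvw ->]]] /ltW qm] := @inf_adherent _ S _ e4; first by split.
  by exists v, w; split => //; apply: Bu => //; exists w.
move=> v w Lvw; apply: rdot_hdot => c.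
move: (c *: v) (c *: w) (LZ c _ _ Lvw) => {}v {}w {}Lvw.
apply/eqP; rewrite -subr_eq0; apply/eqP.
(* First variation: [q] is at least [m] at v' + s v, for a near-minimizer v' within [d] of [u]. The
   choice of [N] and [d] keeps the errors 2 |s| d |v| and d^2 / 4 below [e] in total. *)
apply: (@quadratic_ge0 _ (nrm v ^+ 2)) => s; apply: ler_eps => e e0.
pose N := 1 + 2 * `|s| * nrm v.
have N0 : 0 < N by rewrite /N ltr_wpDr // ?mulr_ge0 ?nrm_ge0.
pose d := Num.min (Num.min 1 e) (e / 2 / N).
have d0 : 0 < d by rewrite !lt_min ltr01 e0 !divr_gt0.
have d4 : 0 < d ^+ 2 / 4 by rewrite divr_gt0 ?exprn_gt0.
have [|_ [v' [w' [Lvw' ->]]] /ltW qm] := @inf_adherent _ S _ d4; first by split.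
have vu : nrm (v' - u) <= d by apply: Bu => //; exists w'.
have := mq _ _ (LD _ _ _ _ Lvw' (LZ s%:C _ _ Lvw)).
move: qm; rewrite /q -!rdotxx !(rdotDl, rdotDr, rdotZl, rdotZr) (rdotC v v') -/m.
move=> qm qm'.
have h1 : s * rdot (v' - u) v <= `|s| * (d * nrm v).
  apply: le_trans (ler_norm _) _; rewrite normrM ler_wpM2l //.
  by apply: le_trans (rdot_norm_le _ _) _; rewrite ler_wpM2r ?nrm_ge0.
have h2 : d * N <= e / 2 by rewrite -ler_pdivlMr // ge_min lexx orbT.
have h3 : d ^+ 2 <= e.
  have d1 : d <= 1 by rewrite !ge_min lexx.
  have de : d <= e by rewrite !ge_min lexx orbT.
  by rewrite expr2 -[e]mul1r ler_pM // ltW.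
rewrite rdotBl in h1; rewrite /N in h2.
by rewrite rdotxx in qm qm' *; nra.
Qed.

End Riesz.

(** * Linear maps *)

Section LinearMaps.
Context {K : pzRingType} {U V : lmodType K} (T : U -> V).
Hypothesis linT : linear T.

Lemma linD x y : T (x + y) = T x + T y.
Proof. by have := linT 1 x y; rewrite !scale1r. Qed.

Lemma lin0 : T 0 = 0.
Proof. by apply: (addrI (T 0)); rewrite -linD !addr0. Qed.

Lemma linZ c x : T (c *: x) = c *: T x.
Proof. by have := linT c x 0; rewrite !addr0 lin0 addr0. Qed.

Lemma linN x : T (- x) = - T x.
Proof. by rewrite -scaleN1r linZ scaleN1r. Qed.

Lemma linB x y : T (x - y) = T x - T y.
Proof. by rewrite linD linN. Qed.

Lemma lin_sum (I : Type) (s : seq I) (f : I -> U) :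
  T (\sum_(i <- s) f i) = \sum_(i <- s) T (f i).
Proof. by elim/big_rec2: _ => [|i u v _ <-]; rewrite ?lin0 ?linD. Qed.

End LinearMaps.

(** * Bounded operators, and adjoints of bounded linear relations *)

Section BoundedOperators.
Local Open Scope complex_scope.
Context {R : realType}.
Implicit Types U V W : hilbertType R.

Lemma bounded_opP V W (T : V -> W) :
  bounded_op T <->
  linear T /\ exists c : R, 0 <= c /\ forall x, nrm (T x) <= c * nrm x.
Proof.
split=> -[linT [c Tc]]; split=> //.
  exists `|c|; split=> // x.
  have := Tc x; rewrite !nrmE -rmorphM lecR => /le_trans; apply.
  by rewrite ler_wpM2r ?nrm_ge0 ?ler_norm.
by case: Tc => _ Tc; exists c => x; rewrite !nrmE -rmorphM lecR.
Qed.

Lemma bounded_lin V W (T : V -> W) : bounded_op T -> linear T.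
Proof. by case. Qed.

Lemma bounded_id V : bounded_op (@id V).
Proof. by apply/bounded_opP; split=> //; exists 1; split=> // x; rewrite mul1r. Qed.

Lemma bounded_comp U V W (S : V -> W) (T : U -> V) :
  bounded_op S -> bounded_op T -> bounded_op (S \o T).
Proof.
move=> /bounded_opP[lS [c [c0 Sc]]] /bounded_opP[lT [d [d0 Td]]].
apply/bounded_opP; split=> [a x y /=|]; first by rewrite lT lS.
exists (c * d); split=> [|x /=]; first exact: mulr_ge0.
by apply: le_trans (Sc _) _; rewrite -mulrA ler_wpM2l.
Qed.

Lemma bounded_lincomb V W (a : R[i]) (S T : V -> W) :
  bounded_op S -> bounded_op T -> bounded_op (a *: S + T).
Proof.
move=> /bounded_opP[lS [c [c0 Sc]]] /bounded_opP[lT [d [d0 Td]]].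
apply/bounded_opP; split=> [b x y /=|].
  rewrite !fctE lS lT !scalerDr !scalerA (mulrC a) -!addrA; congr (_ + _).
  by rewrite addrCA.
exists (complex.Re `|a| * c + d); split=> [|x].
  by rewrite addr_ge0 ?mulr_ge0 ?Re_norm_ge0.
rewrite !fctE mulrDl; apply: le_trans (nrmD _ _) _; apply: lerD => //.
by rewrite nrmZ -mulrA ler_wpM2l ?Re_norm_ge0.
Qed.

Lemma bounded0 V W : bounded_op (0 : V -> W).
Proof.
apply/bounded_opP; split=> [a x y|].
  by rewrite -![(0 : V -> W) _]/(0 : W) scaler0 addr0.
by exists 0; split=> // x; rewrite mul0r -[(0 : V -> W) x]/(0 : W) nrm0.
Qed.

Lemma boundedD V W (S T : V -> W) :
  bounded_op S -> bounded_op T -> bounded_op (S + T).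
Proof. by move=> bS bT; have := bounded_lincomb 1 bS bT; rewrite scale1r. Qed.

Lemma boundedZ V W (a : R[i]) (S : V -> W) : bounded_op S -> bounded_op (a *: S).
Proof.
by move=> bS; have := bounded_lincomb a bS (bounded0 V W); rewrite addr0.
Qed.

Lemma boundedB V W (S T : V -> W) :
  bounded_op S -> bounded_op T -> bounded_op (S - T).
Proof. by move=> bS bT; rewrite -scaleN1r addrC; exact: bounded_lincomb. Qed.

Lemma bounded_sum V W (I : Type) (s : seq I) (f : I -> V -> W) :
  (forall i, bounded_op (f i)) -> bounded_op (\sum_(i <- s) f i).
Proof.
by move=> h; apply: big_ind => // [|S T]; [exact: bounded0 | exact: boundedD].
Qed.

Definition adherent V (D : set V) (z : V) :=
  forall e : R, 0 < e -> exists v, D v /\ nrm (v - z) <= e.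

Lemma adherent_lin V (D : set V) (c : R[i]) z z' :
  (forall v v', D v -> D v' -> D (c *: v + v')) ->
  adherent D z -> adherent D z' -> adherent D (c *: z + z').
Proof.
move=> Dlin hz hz' e e0; pose N := complex.Re `|c| + 1.
have c0 := Re_norm_ge0 c.
have N0 : 0 < N by rewrite ltr_wpDl.
have eN : 0 < e / N by rewrite divr_gt0.
have [v [Dv vz]] := hz _ eN; have [v' [Dv' vz']] := hz' _ eN.
exists (c *: v + v'); split; first exact: Dlin.
rewrite opprD addrACA -scalerBr; apply: le_trans (nrmD _ _) _.
rewrite nrmZ -[e](divfK (lt0r_neq0 N0)) [_ / _ * _]mulrC {2}/N mulrDl mul1r.
by apply: lerD => //; rewrite ler_wpM2l.
Qed.

(** For [v] in [D] near [z], |z|^2 = <z, z - v> is small. *)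
Lemma adherent_orth0 V (D : set V) z :
  adherent D z -> (forall v, D v -> rdot z v = 0) -> z = 0.
Proof.
move=> hz z0; apply: nrm_eq0; apply/eqP; rewrite -sqrf_eq0 -rdotxx.
apply/eqP/le_anti; rewrite {2}rdotxx sqr_ge0 andbT.
apply: (@ler_epsM _ _ _ (nrm z)) => [|e e0]; first exact: nrm_ge0.
have [v [Dv vz]] := hz _ e0.
rewrite add0r -{2}[z](subrK v) rdotDr (z0 v) // addr0.
by apply: le_trans (rdot_le _ _) _; rewrite ler_wpM2l ?nrm_ge0 // nrmB.
Qed.

(** Each [k] receives its Riesz vector in the closure of the domain. There it is unique, so [Y] is
    linear although it is chosen pointwise. Testing [Y k] against nearby vectors of the domain
    bounds it by |C| |k|. *)
Lemma relation_adjoint V W (L : V -> W -> Prop) (C : R) :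
  linear_relation L -> (forall v w, L v w -> nrm w <= C * nrm v) ->
  exists2 Y : W -> V, bounded_op Y &
    (forall k, adherent [set v | exists w, L v w] (Y k)) /\
    (forall k v w, L v w -> hdot (Y k) v = hdot k w).
Proof.
move=> linL LC.
have /choice[Y hY] := fun k => relation_riesz k linL LC.
pose D : set V := [set v | exists w, L v w].
have Dlin (c : R[i]) v v' : D v -> D v' -> D (c *: v + v').
  by move=> [w Lvw] [w' Lvw']; exists (c *: w + w'); exact: linL.2.
have aY k : adherent D (Y k).
  by move=> e /(hY k).2 [v [w [Lvw h]]]; exists v; split => //; exists w.
exists Y; last by split=> // k; exact: (hY k).1.
apply/bounded_opP; split.
  move=> c k k'; apply/eqP; rewrite -subr_eq0; apply/eqP.
  apply: (@adherent_orth0 _ D).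
    rewrite (_ : _ - _ = -1 *: (c *: Y k + Y k') + Y (c *: k + k')).
      apply: (adherent_lin (Dlin _)) => //.
      by apply: (adherent_lin (Dlin _)).
    by rewrite scaleN1r [LHS]addrC.
  move=> v [w Lvw]; rewrite rdotBl rdotDl /rdot hdotZl.
  have hYE x := (hY x).1 v w Lvw.
  by rewrite !hYE hdotDl hdotZl raddfD /= opprD addrACA !subrr addr0.
exists `|C|; split=> // k.
have [->|yn0] := eqVneq (nrm (Y k)) 0; first by rewrite mulr_ge0 ?nrm_ge0.
have ygt : 0 < nrm (Y k) by rewrite lt_neqAle eq_sym yn0 nrm_ge0.
rewrite -(ler_pM2l ygt) -expr2 -rdotxx.
apply: (@ler_epsM _ _ _ (nrm (Y k) + nrm k * `|C|)).
  by rewrite addr_ge0 ?mulr_ge0 ?nrm_ge0.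
move=> e e0; have [v [[w Lvw] vy]] := aY k e e0.
have h1 : rdot (Y k) (Y k - v) <= nrm (Y k) * e.
  by apply: le_trans (rdot_le _ _) _; rewrite ler_pM2l // nrmB.
have h2 : rdot (Y k) v <= nrm k * (`|C| * (nrm (Y k) + e)).
  rewrite /rdot ((hY k).1 _ _ Lvw); apply: le_trans (rdot_le _ _) _.
  rewrite ler_wpM2l ?nrm_ge0 //; apply: le_trans (LC _ _ Lvw) _.
  apply: le_trans (_ : `|C| * nrm v <= _).
    by rewrite ler_wpM2r ?nrm_ge0 ?ler_norm.
  rewrite ler_wpM2l // -[v](subrK (Y k)) addrC; apply: le_trans (nrmD _ _) _.
  by rewrite lerD2l.
by move: h1 h2; rewrite rdotBr; nra.
Qed.

End BoundedOperators.

(** * Adjoints, operator norms and inverses of coercive operators *)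

Section Adjoints.
Local Open Scope complex_scope.
Context {R : realType}.
Implicit Types U V W : hilbertType R.

(** The adjoint of the graph of [T], seen as a relation, rules out the default value of [xget]. *)
Lemma adj_spec V W (T : V -> W) : bounded_op T ->
  bounded_op (adj T) /\ forall x y, hdot (T x) y = hdot x (adj T y).
Proof.
move=> bT; rewrite /adj; case: xgetP => // /(_ _) noadj; exfalso.
have [lT [c [c0 Tc]]] := iffLR (bounded_opP T) bT.
have [| |Y bY [_ YT]] := @relation_adjoint _ V W (fun v w => w = T v) c.
- by split=> [|a v v' w w' -> ->]; rewrite ?lin0 // lT.
- by move=> v _ ->.
apply: (noadj Y); split=> // x y.
by rewrite hdot_conj -(YT y x _ erefl) -hdot_conj.
Qed.

Lemma bounded_adj V W (T : V -> W) : bounded_op T -> bounded_op (adj T).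
Proof. by case/adj_spec. Qed.

Lemma hdot_adj V W (T : V -> W) x y : bounded_op T ->
  hdot x (adj T y) = hdot (T x) y.
Proof. by case/adj_spec => _ ->. Qed.

Lemma hdot_adjl V W (T : V -> W) x y : bounded_op T ->
  hdot (adj T y) x = hdot y (T x).
Proof. by move=> bT; rewrite hdot_conj hdot_adj // -hdot_conj. Qed.

Lemma rdot_adj V W (T : V -> W) x y : bounded_op T ->
  rdot x (adj T y) = rdot (T x) y.
Proof. by move=> bT; rewrite /rdot hdot_adj. Qed.

Lemma rdot_adjl V W (T : V -> W) x y : bounded_op T ->
  rdot (adj T y) x = rdot y (T x).
Proof. by move=> bT; rewrite rdotC rdot_adj // rdotC. Qed.

Lemma adj_eq V W (T : V -> W) (S : W -> V) : bounded_op T ->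
  (forall x y, hdot (T x) y = hdot x (S y)) -> adj T = S.
Proof.
move=> bT h; apply/funext => y; apply: hdot_ext => x.
by rewrite hdot_adjl // hdot_conj h -hdot_conj.
Qed.

Lemma adjK V W (T : V -> W) : bounded_op T -> adj (adj T) = T.
Proof.
by move=> bT; apply: adj_eq => [|x y]; [exact: bounded_adj | rewrite hdot_adjl].
Qed.

Lemma adj_comp U V W (S : V -> W) (T : U -> V) :
  bounded_op S -> bounded_op T -> adj (S \o T) = adj T \o adj S.
Proof.
move=> bS bT; apply: adj_eq => [|x y /=]; first exact: bounded_comp.
by rewrite !hdot_adj.
Qed.

Lemma adj_lincomb V W (a : R[i]) (S T : V -> W) : bounded_op S -> bounded_op T ->
  adj (a *: S + T) = a^* *: adj S + adj T.
Proof.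
move=> bS bT; apply: adj_eq => [|x y]; first exact: bounded_lincomb.
by rewrite !fctE hdotDl hdotDr hdotZl hdotZr !hdot_adj.
Qed.

Lemma adj_id V : adj (@id V) = id.
Proof. by apply: adj_eq => //; exact: bounded_id. Qed.

Lemma adj0 V W : adj (0 : V -> W) = 0.
Proof.
apply: adj_eq => [|x y]; first exact: bounded0.
rewrite hdot_conj -[(0 : V -> W) x]/(0 : W) -[(0 : W -> V) y]/(0 : V).
by rewrite !hdot0r rmorph0.
Qed.

Lemma adjD V W (S T : V -> W) : bounded_op S -> bounded_op T ->
  adj (S + T) = adj S + adj T.
Proof. by move=> bS bT; have := adj_lincomb 1 bS bT; rewrite rmorph1 !scale1r. Qed.

Lemma adj_scale V W (a : R[i]) (S : V -> W) : bounded_op S ->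
  adj (a *: S) = a^* *: adj S.
Proof.
by move=> bS; have := adj_lincomb a bS (bounded0 V W); rewrite adj0 !addr0.
Qed.

Lemma adjB V W (S T : V -> W) : bounded_op S -> bounded_op T ->
  adj (S - T) = adj S - adj T.
Proof.
move=> bS bT; rewrite -scaleN1r addrC adj_lincomb // rmorphN1 scaleN1r.
by rewrite addrC.
Qed.

Lemma adj_sum V W (I : Type) (s : seq I) (f : I -> V -> W) :
  (forall i, bounded_op (f i)) ->
  adj (\sum_(i <- s) f i) = \sum_(i <- s) adj (f i).
Proof.
move=> h; elim: s => [|i s IH]; first by rewrite !big_nil adj0.
by rewrite !big_cons adjD ?IH //; exact: bounded_sum.
Qed.

Lemma opnorm_has_sup V W (T : V -> W) : bounded_op T ->
  has_sup [set complex.Re `|T x| | x in [set x : V | `|x| <= 1]].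
Proof.
move=> /bounded_opP[lT [c [c0 Tc]]]; split.
  by exists (nrm (T 0)), 0 => //=; rewrite normr0.
exists c => _ [x /= x1 <-]; apply: le_trans (Tc x) _.
by rewrite ler_piMr // -lecR -nrmE.
Qed.

Lemma opnorm_ge0 V W (T : V -> W) : bounded_op T -> 0 <= opnorm T.
Proof.
move=> bT; apply: le_trans (nrm_ge0 (T 0)) _; apply: ub_le_sup.
  by case: (opnorm_has_sup bT).
by exists 0 => //=; rewrite normr0.
Qed.

Lemma nrm_opnorm V W (T : V -> W) x : bounded_op T ->
  nrm (T x) <= opnorm T * nrm x.
Proof.
move=> bT; have lT := bounded_lin bT.
have [/nrm_eq0 ->|x0] := eqVneq (nrm x) 0; first by rewrite lin0 // !nrm0 mulr0.
have xgt : 0 < nrm x by rewrite lt_neqAle eq_sym x0 nrm_ge0.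
have xV : 0 <= (nrm x)^-1 by rewrite invr_ge0 nrm_ge0.
rewrite -ler_pdivrMr // mulrC -nrmZr // -linZ //.
apply: ub_le_sup; first by case: (opnorm_has_sup bT).
by exists ((nrm x)^-1%:C *: x) => //=; rewrite nrmE nrmZr // mulVf // lecR.
Qed.

Lemma opnorm_le V W (T : V -> W) (c : R) : 0 <= c ->
  (forall x, nrm (T x) <= c * nrm x) -> opnorm T <= c.
Proof.
move=> c0 Tc; apply: ge_sup; first by exists (nrm (T 0)), 0 => //=; rewrite normr0.
by move=> _ [x /= x1 <-]; apply: le_trans (Tc x) _; rewrite ler_piMr // -lecR -nrmE.
Qed.

(** The module norm for the product [adj T \o S]. By [nrm_hnorm] and [hnorm_le] it is the least
    bound of a bounded [T]. *)
Definition hnorm V W (T : V -> W) : R := Num.sqrt (opnorm (adj T \o T)).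

Lemma hnorm_ge0 V W (T : V -> W) : 0 <= hnorm T.
Proof. exact: sqrtr_ge0. Qed.

Lemma rdot_adj_comp V W (T : V -> W) x : bounded_op T ->
  rdot x ((adj T \o T) x) = nrm (T x) ^+ 2.
Proof. by move=> bT; rewrite /= rdot_adj // rdotxx. Qed.

Lemma nrm_hnorm V W (T : V -> W) x : bounded_op T ->
  nrm (T x) <= hnorm T * nrm x.
Proof.
move=> bT; have bTT := bounded_comp (bounded_adj bT) bT.
rewrite -(@ler_pXn2r _ 2) ?nnegrE ?nrm_ge0 ?mulr_ge0 ?hnorm_ge0 ?nrm_ge0 //.
rewrite exprMn sqr_sqrtr ?opnorm_ge0 // -rdot_adj_comp //.
apply: le_trans (rdot_le _ _) _; rewrite mulrC expr2 mulrA ler_wpM2r ?nrm_ge0 //.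
exact: nrm_opnorm.
Qed.

Lemma nrm_adj V W (T : V -> W) (c : R) : bounded_op T -> 0 <= c ->
  (forall x, nrm (T x) <= c * nrm x) -> forall y, nrm (adj T y) <= c * nrm y.
Proof.
move=> bT c0 Tc y; have [->|n0] := eqVneq (nrm (adj T y)) 0.
  by rewrite mulr_ge0 ?nrm_ge0.
have ngt : 0 < nrm (adj T y) by rewrite lt_neqAle eq_sym n0 nrm_ge0.
rewrite -(ler_pM2r ngt) -expr2 -rdotxx rdot_adj // mulrAC.
by apply: le_trans (rdot_le _ _) _; rewrite ler_wpM2r ?nrm_ge0 ?Tc.
Qed.

Lemma hnorm_le V W (T : V -> W) (c : R) : bounded_op T -> 0 <= c ->
  (forall x, nrm (T x) <= c * nrm x) -> hnorm T <= c.
Proof.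
move=> bT c0 Tc; rewrite -[c]ger0_norm // -sqrtr_sqr; apply: ler_wsqrtr.
apply: opnorm_le => [|x /=]; first exact: sqr_ge0.
rewrite expr2 -mulrA; apply: le_trans (nrm_adj bT c0 Tc _) _.
by rewrite ler_wpM2l.
Qed.

Lemma coercive_inj V (A : V -> V) (e : R) : 0 < e ->
  (forall x, e * nrm x ^+ 2 <= rdot x (A x)) ->
  forall x, e * nrm x <= nrm (A x).
Proof.
move=> e0 Ae x; have [->|n0] := eqVneq (nrm x) 0; first by rewrite mulr0 nrm_ge0.
have ngt : 0 < nrm x by rewrite lt_neqAle eq_sym n0 nrm_ge0.
rewrite -(ler_pM2l ngt); apply: le_trans (rdot_le _ _).
by apply: le_trans (Ae x); rewrite mulrCA expr2.
Qed.

(** Coercivity bounds the relation A w |-> w by 1 / e. Its adjoint [Y] satisfies <Y k, A x> = <k,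
    x>, which for self-adjoint [A] says that A Y k = k. *)
Lemma coercive_inverse V (A : V -> V) (e : R) : bounded_op A -> adj A = A ->
  0 < e -> (forall x, e * nrm x ^+ 2 <= rdot x (A x)) ->
  exists2 Y, bounded_op Y & A \o Y = id.
Proof.
move=> bA sA e0 Ae; have lA := bounded_lin bA.
have [| |Y bY [_ YA]] := @relation_adjoint _ V V (fun v w => v = A w) e^-1.
- by split=> [|a v v' w w' -> ->]; rewrite ?lin0 // lA.
- by move=> v w ->; rewrite ler_pdivlMl //; exact: coercive_inj Ae _.
exists Y => //; apply/funext => k /=; apply: hdot_ext => x.
by rewrite -(YA k _ x erefl) -{1}sA hdot_adjl.
Qed.

End Adjoints.

(** * Symmetric and positive operators *)

Section Positivity.
Local Open Scope complex_scope.
Context {R : realType}.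
Implicit Types U V W : hilbertType R.

(** Log-convexity makes the ratios of successive terms nondecreasing. If p = a 1 / a 0 exceeded [r],
    then a n >= a 0 p^n would outgrow k r^n, by Bernoulli's inequality for p / r. *)
Lemma log_convex_growth (a : nat -> R) (k r : R) : 0 <= r ->
  (forall n, 0 <= a n) -> (forall n, a n.+1 ^+ 2 <= a n * a n.+2) ->
  (forall n, a n <= k * r ^+ n) -> a 1%N <= r * a 0%N.
Proof.
move=> r0 a0 ac ak; rewrite leNgt; apply/negP => h.
have a1 : 0 < a 1%N by apply: le_lt_trans h; rewrite mulr_ge0.
have a00 : 0 < a 0%N.
  rewrite lt_neqAle a0 andbT eq_sym; apply/eqP => a00.
  by have := ac 0%N; rewrite a00 mul0r; apply/negP; rewrite -ltNge exprn_gt0.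
have step n : 0 < a n /\ a 1%N * a n <= a 0%N * a n.+1.
  elim: n => [|n [an IH]]; first by split=> //; rewrite mulrC.
  have an1 : 0 < a n.+1.
    by rewrite -(pmulr_rgt0 _ a00); apply: lt_le_trans IH; rewrite mulr_gt0.
  split=> //; rewrite -(ler_pM2l an1).
  have h1 : a n.+1 * (a 1%N * a n.+1) <= a 1%N * (a n * a n.+2).
    by rewrite mulrCA -expr2 ler_pM2l.
  apply: le_trans h1 _; rewrite mulrA.
  have : a 1%N * a n * a n.+2 <= a 0%N * a n.+1 * a n.+2 by rewrite ler_wpM2r.
  by move=> h2; apply: le_trans h2 _; rewrite mulrCA mulrA.
pose p := a 1%N / a 0%N.
have p0 : 0 < p by rewrite divr_gt0.
have geo n : a 0%N * p ^+ n <= a n.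
  elim: n => [|n IH]; first by rewrite expr0 mulr1.
  have : p * (a 0%N * p ^+ n) <= p * a n by rewrite ler_pM2l.
  rewrite mulrCA -exprS => /le_trans; apply.
  by rewrite /p mulrAC ler_pdivrMr // [leRHS]mulrC; exact: (step n).2.
have rp : r < p by rewrite /p ltr_pdivlMr.
have [r00|r00] := eqVneq r 0.
  by have := ak 1%N; rewrite r00 expr1 mulr0 leNgt a1.
have rgt : 0 < r by rewrite lt_neqAle eq_sym r00.
pose t := p / r - 1.
have t0 : 0 < t by rewrite subr_gt0 ltr_pdivlMr // mul1r.
have bern n : 1 + t * n%:R <= (p / r) ^+ n.
  elim: n => [|n IH]; first by rewrite mulr0 addr0.
  have -> : (p / r) ^+ n.+1 = t * (p / r) ^+ n + (p / r) ^+ n.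
    by rewrite /t mulrBl mul1r subrK exprS.
  have h1 : t * 1 <= t * (p / r) ^+ n.
    rewrite ler_pM2l //; apply: le_trans IH; rewrite lerDl mulr_ge0 //.
    exact: ltW.
  by rewrite -natr1; move: IH h1; set X := _ ^+ n; lra.
pose n := Num.truncn (k / a 0%N / t).
have := bern n.+1.
have : (p / r) ^+ n.+1 <= k / a 0%N.
  rewrite expr_div_n ler_pdivrMr ?exprn_gt0 // mulrAC ler_pdivlMr // mulrC.
  exact: le_trans (geo _) (ak _).
move=> h1 h2; have := le_trans h2 h1.
rewrite leNgt => /negP; apply.
apply: (@lt_le_trans _ _ (t * n.+1%:R)); last by rewrite lerDr.
by rewrite [ltRHS]mulrC -ltr_pdivrMr // truncnS_gt.
Qed.

(* Stands in for the C*-identity on a space that need not be complete: bounds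
   on a symmetric map follow from crude growth bounds on its orbits. *)
Lemma symmetric_orbit V (v : nat -> V) (k r : R) : 0 <= r ->
  (forall n m, rdot (v n.+1) (v m) = rdot (v n) (v m.+1)) ->
  (forall n, nrm (v n) <= k * r ^+ n) -> nrm (v 1%N) <= r * nrm (v 0%N).
Proof.
move=> r0 vs vk; apply: (@log_convex_growth (nrm \o v) k r) => //= n.
  exact: nrm_ge0.
by rewrite -rdotxx vs rdot_le.
Qed.

Lemma adj_eq_rdot V W (T : V -> W) (S : W -> V) : bounded_op T -> linear S ->
  (forall x y, rdot (T x) y = rdot x (S y)) -> adj T = S.
Proof.
move=> bT lS h; apply: adj_eq => // x y; apply: rdot_hdot => c.
by rewrite h (linZ lS).
Qed.

Definition selfadj V (S : V -> V) := bounded_op S /\ adj S = S.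

Lemma selfadjB V (S T : V -> V) : selfadj S -> selfadj T -> selfadj (S - T).
Proof.
by move=> [bS sS] [bT sT]; split; [exact: boundedB | rewrite adjB // sS sT].
Qed.

Lemma selfadj_Im V (S : V -> V) x : selfadj S -> complex.Im (hdot x (S x)) = 0.
Proof.
move=> [bS sS]; have : hdot x (S x) = (hdot x (S x))^*.
  by rewrite -hdot_conj -{1}sS hdot_adj.
case: (hdot x (S x)) => u w [/= h].
by apply/eqP; rewrite -[_ == 0](mulrn_eq0 w 2) mulr2n {1}h addNr.
Qed.

Lemma selfadj_rdot V (S : V -> V) x y : selfadj S -> rdot (S x) y = rdot x (S y).
Proof. by move=> [bS sS]; rewrite -{2}sS rdot_adj. Qed.

Lemma op_leE V (S T : V -> V) : selfadj S -> selfadj T ->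
  op_le S T <-> forall x, rdot x (S x) <= rdot x (T x).
Proof.
move=> sS sT; split=> h x; have := h x; rewrite lecE !selfadj_Im // eqxx //.
Qed.

Lemma positive_opE V (S : V -> V) : selfadj S ->
  positive_op S <-> forall x, 0 <= rdot x (S x).
Proof. by move=> sS; split=> h x; have := h x; rewrite lecE selfadj_Im ?eqxx. Qed.

(** The inequality P^2 <= c P for 0 <= P <= c. Positivity at x + s P x is a quadratic inequality in
    [s]; for c > 0 it is used at s = - 1 / c. *)
Lemma positive_sq V (P : V -> V) (c : R) x : selfadj P -> 0 <= c ->
  (forall x, 0 <= rdot x (P x)) -> (forall x, rdot x (P x) <= c * nrm x ^+ 2) ->
  nrm (P x) ^+ 2 <= c * rdot x (P x).
Proof.
move=> sP c0 P0 Pc; have lP := bounded_lin sP.1.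
have quad s : 0 <= rdot x (P x) + 2 * s * nrm (P x) ^+ 2 + s ^+ 2 * (c * nrm (P x) ^+ 2).
  have := P0 (x + s%:C *: P x); rewrite (linD lP) (linZ lP) rdotDl !rdotDr !rdotZl !rdotZr.
  rewrite -[rdot x (P (P x))]selfadj_rdot // rdotxx => h; apply: le_trans h _.
  by have := ler_wpM2l (sqr_ge0 s) (Pc (P x)); nra.
have [c00|cn0] := eqVneq c 0.
  rewrite c00 mul0r.
  suff -> : nrm (P x) ^+ 2 = 0 by [].
  apply/eqP/negPn/negP => n0.
  (* For c = 0 the expression is affine in [s], and this [s] gives it the value -1. *)
  have := quad (- (rdot x (P x) + 1) / 2 / nrm (P x) ^+ 2).
  rewrite c00 mul0r mulr0 addr0.
  suff -> : 2 * (- (rdot x (P x) + 1) / 2 / nrm (P x) ^+ 2) * nrm (P x) ^+ 2 =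
    - (rdot x (P x) + 1) by lra.
  by field; rewrite -sqrf_eq0.
have cgt : 0 < c by rewrite lt_neqAle eq_sym cn0.
rewrite -subr_ge0; have := mulr_ge0 c0 (quad (- c^-1)).
suff -> : c * (rdot x (P x) + 2 * - c^-1 * nrm (P x) ^+ 2 +
    (- c^-1) ^+ 2 * (c * nrm (P x) ^+ 2)) = c * rdot x (P x) - nrm (P x) ^+ 2 by [].
by field.
Qed.

Lemma rdot_opnorm V (T : V -> V) x : bounded_op T ->
  rdot x (T x) <= opnorm T * nrm x ^+ 2.
Proof.
move=> bT; apply: le_trans (rdot_le _ _) _.
by rewrite mulrC expr2 mulrA ler_wpM2r ?nrm_ge0 // nrm_opnorm.
Qed.

(** The quadratic form of S - T vanishes, so [positive_sq] with c = 0 gives S - T = 0. *)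
Lemma op_le_antisym V (S T : V -> V) : selfadj S -> selfadj T ->
  op_le S T -> op_le T S -> S = T.
Proof.
move=> sS sT ST TS; have sP := selfadjB sS sT.
have P0 x : rdot x ((S - T) x) = 0.
  rewrite rdotBr; apply/eqP; rewrite subr_eq0; apply/eqP/le_anti.
  by rewrite (iffLR (op_leE sS sT) ST) (iffLR (op_leE sT sS) TS).
apply/funext => x; apply/eqP; rewrite -subr_eq0; apply/eqP/nrm_eq0/eqP.
rewrite -sqrf_eq0; apply/eqP/le_anti; rewrite sqr_ge0 andbT.
have := @positive_sq _ (S - T) 0 x sP (lexx _); rewrite mul0r; apply.
  by move=> y; rewrite P0.
by move=> y; rewrite P0 mul0r.
Qed.

Lemma positive_nrm V (P : V -> V) (c : R) x : selfadj P -> 0 <= c ->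
  (forall x, 0 <= rdot x (P x)) -> (forall x, rdot x (P x) <= c * nrm x ^+ 2) ->
  nrm (P x) <= c * nrm x.
Proof.
move=> sP c0 P0 Pc.
rewrite -(@ler_pXn2r _ 2) ?nnegrE ?nrm_ge0 ?mulr_ge0 ?nrm_ge0 //.
apply: le_trans (positive_sq x sP c0 P0 Pc) _.
by rewrite exprMn expr2 -mulrA ler_wpM2l.
Qed.

End Positivity.

(** * Strong limits of bounded increasing nets of self-adjoint operators *)

Section Vigier.
Local Open Scope complex_scope.
Context {R : realType} {V : hilbertType R}.
Variables (D : set (V -> V)) (u : V -> V).
Hypothesis Dsa : D `<=` @selfadj R V.
Hypothesis Ddir : directed_by op_le D.

(** A directed set is treated as a net indexed by itself; these are the properties that hold on a
    tail. *)
Definition eventually_in (P : (V -> V) -> Prop) :=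
  exists2 d0, D d0 & forall d, D d -> op_le d0 d -> P d.

Lemma eventually_inI P Q : eventually_in P -> eventually_in Q ->
  eventually_in (fun d => P d /\ Q d).
Proof.
move=> [d1 Dd1 h1] [d2 Dd2 h2]; have [d3 [Dd3 le1 le2]] := Ddir.2 _ _ Dd1 Dd2.
exists d3 => // d Dd le3; split.
  by apply: h1 => // x; exact: le_trans (le1 x) (le3 x).
by apply: h2 => // x; exact: le_trans (le2 x) (le3 x).
Qed.

Lemma eventually_in_ex P : eventually_in P -> exists2 d, D d & P d.
Proof. by move=> [d0 Dd0 h]; exists d0 => //; apply: h => // x; exact: lexx. Qed.

Lemma eventually_in_ge d : D d -> eventually_in (op_le d).
Proof. by move=> Dd; exists d. Qed.

Definition strong_limit (s : V -> V) :=
  forall x e, 0 < e -> eventually_in (fun d => nrm (d x - s x) <= e).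

Lemma strong_limit_ub s : strong_limit s -> selfadj s ->
  forall d, D d -> op_le d s.
Proof.
move=> lims sas d Dd; apply/op_leE => //; first exact: Dsa.
move=> x; apply: (@ler_epsM _ _ _ (nrm x)) => [|e e0]; first exact: nrm_ge0.
have [d' Dd' [h dd']] :=
  eventually_in_ex (eventually_inI (lims x e e0) (eventually_in_ge Dd)).
apply: le_trans (iffLR (op_leE (Dsa Dd) (Dsa Dd')) dd' x) _.
rewrite -lerBlDl -rdotBr; apply: le_trans (rdot_le _ _) _.
by rewrite ler_wpM2l ?nrm_ge0.
Qed.

Lemma strong_limit_least s : strong_limit s -> selfadj s ->
  forall v, selfadj v -> (forall d, D d -> op_le d v) -> op_le s v.
Proof.
move=> lims sas v sav ubv; apply/op_leE => // x.
apply: (@ler_epsM _ _ _ (nrm x)) => [|e e0]; first exact: nrm_ge0.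
have [d Dd h] := eventually_in_ex (lims x e e0).
have := iffLR (op_leE (Dsa Dd) sav) (ubv d Dd) x.
have : rdot x (s x - d x) <= nrm x * e.
  by apply: le_trans (rdot_le _ _) _; rewrite nrmB ler_wpM2l ?nrm_ge0.
rewrite rdotBr; lra.
Qed.

(** For fixed [x] the numbers <x, d x> increase to a finite supremum, and [positive_sq] turns a
    small increment of the form into a small |d' x - d x|. *)
Lemma directed_strong_limit : selfadj u -> (forall d, D d -> op_le d u) ->
  exists2 s, selfadj s & strong_limit s.
Proof.
move=> sau ubu; have [d0 Dd0] := Ddir.1.
(* Beyond [d0] every increment satisfies 0 <= d' - d <= u - d0, so [c] serves in [positive_sq]. *)
pose c := opnorm (u - d0).
have c0 : 0 <= c by apply: opnorm_ge0; exact: (selfadjB sau (Dsa Dd0)).1.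
have le3 d1 d2 d3 : op_le d1 d2 -> op_le d2 d3 -> op_le d1 (d3 : V -> V).
  by move=> h1 h2 x; exact: le_trans (h1 x) (h2 x).
have incr d d' x : D d -> D d' -> op_le d0 d -> op_le d d' ->
    nrm (d' x - d x) ^+ 2 <= c * rdot x (d' x - d x).
  move=> Dd Dd' d0d dd'.
  apply: (positive_sq x (selfadjB (Dsa Dd') (Dsa Dd)) c0) => {x} x; rewrite rdotBr.
    by rewrite subr_ge0; exact: (iffLR (op_leE (Dsa Dd) (Dsa Dd'))).
  have h := rdot_opnorm x (selfadjB sau (Dsa Dd0)).1.
  apply: le_trans h; rewrite rdotBr; apply: lerB.
    by apply: (iffLR (op_leE (Dsa Dd') sau)); exact: ubu.
  exact: (iffLR (op_leE (Dsa Dd0) (Dsa Dd))).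
pose S x : set R := [set r | exists2 d, D d & r = rdot x (d x)].
have supS x : has_sup (S x).
  split; first by exists (rdot x (d0 x)), d0.
  exists (rdot x (u x)) => _ [d Dd ->].
  by apply: (iffLR (op_leE (Dsa Dd) sau)); exact: ubu.
have supP x d : D d -> rdot x (d x) <= sup (S x).
  by move=> Dd; apply: (ub_le_sup (supS x).2); exists d.
(* Chosen so that (c + 1) g e = (e / 2)^2; the 1 covers the case c = 0. *)
pose g e : R := e ^+ 2 / (4 * (c + 1)).
have c1 : 0 < c + 1 by rewrite ltr_wpDl.
have g0 e : 0 < e -> 0 < g e by move=> e0; rewrite divr_gt0 ?exprn_gt0 ?mulr_gt0.
have near x e : 0 < e -> exists d, [/\ D d, op_le d0 d & sup (S x) - g e <= rdot x (d x)].
  move=> e0; have [_ [d Dd ->] /ltW h] := sup_adherent (g0 _ e0) (supS x).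
  have [d' [Dd' h1 h2]] := Ddir.2 _ _ Dd0 Dd; exists d'; split=> //.
  by apply: le_trans h _; exact: (iffLR (op_leE (Dsa Dd) (Dsa Dd'))).
have dist d d' x e : 0 < e -> D d -> D d' -> op_le d0 d -> op_le d d' ->
    sup (S x) - g e <= rdot x (d x) -> nrm (d' x - d x) <= e / 2.
  move=> e0 Dd Dd' d0d dd' h; have e2 : 0 < e / 2 by rewrite divr_gt0.
  rewrite -(@ler_pXn2r _ 2) ?nnegrE ?nrm_ge0 ?(ltW e2) //.
  apply: le_trans (incr _ _ _ Dd Dd' d0d dd') _.
  apply: (@le_trans _ _ (c * g e)).
    by rewrite ler_wpM2l // rdotBr; have := supP x _ Dd'; lra.
  apply: (@le_trans _ _ ((c + 1) * g e)).
    by rewrite ler_wpM2r ?(ltW (g0 _ e0)) // lerDl.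
  suff -> : (c + 1) * g e = (e / 2) ^+ 2 by [].
  by rewrite /g; field; rewrite gt_eqF.
(* Values at [x] of the [d] beyond [d0] whose form is within [g e] of its supremum. Two such values
   are compared through a common upper bound, each at distance at most e / 2 from it. *)
pose B x e : set V :=
  [set w | exists d, [/\ D d, op_le d0 d, sup (S x) - g e <= rdot x (d x) & w = d x]].
have /choice[s sP] : forall x, exists w, forall e y, 0 < e -> B x e y -> nrm (y - w) <= e.
  move=> x; apply: complete_nested.
  - by move=> e e0; have [d [? ? ?]] := near x e e0; exists (d x), d.
  - move=> e e' e0 ee' _ [d [Dd d0d h ->]]; exists d; split=> //.
    apply: le_trans h; rewrite lerD2l lerN2 ler_pM2r ?invr_gt0 ?mulr_gt0 //.
    by rewrite lerXn2r // nnegrE ltW // (lt_le_trans e0).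
  - move=> e _ _ e0 [d [Dd d0d h ->]] [d' [Dd' d0d' h' ->]].
    have [d2 [Dd2 h1 h2]] := Ddir.2 _ _ Dd Dd'.
    rewrite -(subrKA (d2 x)); apply: le_trans (nrmD _ _) _.
    rewrite nrmB [e]splitr; apply: lerD; exact: dist.
have lims : strong_limit s.
  move=> x e e0; have [d [Dd d0d h]] := near x e e0.
  exists d => // d' Dd' dd'; apply: sP => //; exists d'; split=> //.
    exact: le3 d0d dd'.
  by apply: le_trans h _; exact: (iffLR (op_leE (Dsa Dd) (Dsa Dd'))).
have lins : linear s.
  move=> a x y; apply/eqP; rewrite -subr_eq0; apply/eqP/nrm_eq0/le_anti.
  rewrite nrm_ge0 andbT.
  have a0 := Re_norm_ge0 a.
  apply: (@ler_epsM _ _ _ (complex.Re `|a| + 2)) => [|e e0]; first exact: addr_ge0.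
  have [d Dd [[h1 h2] h3]] := eventually_in_ex (eventually_inI
    (eventually_inI (lims x e e0) (lims y e e0)) (lims (a *: x + y) e e0)).
  have -> : s (a *: x + y) - (a *: s x + s y) =
      a *: (d x - s x) + (d y - s y) - (d (a *: x + y) - s (a *: x + y)).
    rewrite (bounded_lin (Dsa Dd).1) scalerBr.
    by rewrite [in RHS]addrACA -[in RHS]opprD opprB [RHS]addrC addrA subrK.
  apply: le_trans (nrmD _ _) _; rewrite nrmN.
  have h4 := nrmD (a *: (d x - s x)) (d y - s y).
  have : complex.Re `|a| * nrm (d x - s x) <= complex.Re `|a| * e by rewrite ler_wpM2l.
  by rewrite nrmZ in h4; lra.
exists s => //.
have bs : bounded_op s.
  apply/bounded_opP; split=> //; exists (opnorm d0 + c).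
  split=> [|x]; first by rewrite addr_ge0 // opnorm_ge0 //; exact: (Dsa Dd0).1.
  apply: ler_eps => e e0.
  have [d Dd [h d0d]] :=
    eventually_in_ex (eventually_inI (lims x e e0) (eventually_in_ge Dd0)).
  have h1 : nrm (d x - d0 x) <= c * nrm x.
    rewrite -(@ler_pXn2r _ 2) ?nnegrE ?nrm_ge0 ?mulr_ge0 ?nrm_ge0 //.
    have dd : op_le d0 d0 by move=> ?; exact: lexx.
    apply: le_trans (incr _ _ x Dd0 Dd dd d0d) _; rewrite exprMn expr2 -mulrA ler_wpM2l //.
    apply: le_trans (rdot_opnorm x (selfadjB sau (Dsa Dd0)).1).
    rewrite !rdotBr lerB //.
    by apply: (iffLR (op_leE (Dsa Dd) sau)); exact: ubu.
  have h2 := nrm_opnorm x (Dsa Dd0).1.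
  have h3 : nrm (s x) <= nrm (s x - d x) + nrm (d x - d0 x) + nrm (d0 x).
    rewrite -{1}[s x](subrK (d x)) -{2}[d x](subrK (d0 x)) addrA.
    apply: le_trans (nrmD _ _) _; rewrite lerD2r; exact: nrmD.
  by rewrite (nrmB (s x)) in h3; rewrite mulrDl; lra.
split=> //; apply: adj_eq_rdot => // x y.
apply/eqP; rewrite -subr_eq0 -normr_eq0; apply/eqP/le_anti; rewrite normr_ge0 andbT.
apply: (@ler_epsM _ _ _ (nrm x + nrm y)) => [|e e0]; first by rewrite addr_ge0 ?nrm_ge0.
have [d Dd [h1 h2]] := eventually_in_ex (eventually_inI (lims x e e0) (lims y e e0)).
have -> : rdot (s x) y - rdot x (s y) = rdot x (d y - s y) - rdot (d x - s x) y.
  by rewrite rdotBl rdotBr (selfadj_rdot _ _ (Dsa Dd)); ring.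
rewrite add0r mulrDl; apply: le_trans (ler_normB _ _) _.
apply: lerD; first by apply: le_trans (rdot_norm_le _ _) _; rewrite ler_wpM2l ?nrm_ge0.
by rewrite mulrC; apply: le_trans (rdot_norm_le _ _) _; rewrite ler_wpM2r ?nrm_ge0.
Qed.

End Vigier.

(** * Commutants as von Neumann algebras *)

Section Commutants.
Local Open Scope complex_scope.
Context {R : realType} {V : hilbertType R}.
Variable (A : set (V -> V)).
Hypothesis Abounded : A `<=` bounded_op.

Lemma commutantP T S x : commutant A T -> A S -> T (S x) = S (T x).
Proof. by move=> [_ h] AS; have := congr1 (fun f => f x) (h S AS). Qed.

Lemma commutant_id : commutant A id.
Proof. by split; first exact: bounded_id. Qed.

Lemma commutant_lincomb (c : R[i]) S T :
  commutant A S -> commutant A T -> commutant A (c *: S + T).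
Proof.
move=> cS cT; split; first exact: bounded_lincomb cS.1 cT.1.
move=> a Aa; apply/funext => x /=; rewrite !fctE.
by rewrite (commutantP _ cT) // (commutantP _ cS) // (bounded_lin (Abounded Aa)).
Qed.

Lemma commutant0 : commutant A 0.
Proof.
split; first exact: bounded0.
by move=> a Aa; apply/funext => x /=; rewrite -[LHS]/(0 : V) (lin0 (bounded_lin (Abounded Aa))).
Qed.

Lemma commutantZ (c : R[i]) S : commutant A S -> commutant A (c *: S).
Proof. by move=> cS; have := commutant_lincomb c cS commutant0; rewrite addr0. Qed.

Lemma commutantB S T : commutant A S -> commutant A T -> commutant A (S - T).
Proof.
by move=> cS cT; have := commutant_lincomb (-1) cT cS; rewrite scaleN1r addrC.
Qed.

Hypothesis Aadj : forall S, A S -> A (adj S).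

Lemma commutant_adj T : commutant A T -> commutant A (adj T).
Proof.
move=> [bT cT]; split; first exact: bounded_adj.
move=> S AS; have bS := Abounded AS.
by rewrite -(adjK bS) -!adj_comp ?cT //; [exact: Aadj | exact: bounded_adj..].
Qed.

(** The triple commutant equals the commutant, because [A] is contained in its double commutant. *)
Lemma von_neumann_commutant : von_neumann_algebra (commutant A).
Proof.
split; [by move=> T [] | exact: commutant_adj |].
apply/seteqP; split=> T [bT cT]; split=> // S hS.
  by apply: cT; split; [exact: Abounded | move=> T' [_ cT']; rewrite cT'].
by case: hS => _ hS; rewrite hS.
Qed.

(* The strong limit exists among all bounded operators, and it commutes with A,
   so it is also the supremum within the commutant. *)
Lemma commutant_lub_strong_limit (D : set (V -> V)) s :
  D `<=` selfadjoint_part (commutant A) -> directed_by op_le D ->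
  lub_in (selfadjoint_part (commutant A)) op_le D s -> strong_limit D s.
Proof.
move=> DN Ddir [[[bs cs] ss] ubs lubs].
have Dsa : D `<=` @selfadj R V by move=> d /DN [[bd _] sd].
have [s' [bs' ss'] lims'] := directed_strong_limit Dsa Ddir (conj bs ss) ubs.
suff -> : s = s' by [].
have ss's : op_le s' s := strong_limit_least Dsa lims' (conj bs' ss') (conj bs ss) ubs.
apply: op_le_antisym => //; apply: lubs; last exact: strong_limit_ub.
split=> //; split=> // a Aa; apply/funext => x /=.
apply/eqP; rewrite -subr_eq0; apply/eqP/nrm_eq0/le_anti; rewrite nrm_ge0 andbT.
have ba := Abounded Aa.
apply: (@ler_epsM _ _ _ (opnorm a + 1)) => [|e e0]; first by rewrite addr_ge0 ?opnorm_ge0.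
have [d Dd [h1 h2]] :=
  eventually_in_ex (eventually_inI Ddir (lims' (a x) e e0) (lims' x e e0)).
have -> : s' (a x) - a (s' x) = a (d x - s' x) - (d (a x) - s' (a x)).
  rewrite (linB (bounded_lin ba)) (commutantP _ (DN _ Dd).1 Aa).
  by rewrite opprB [RHS]addrC addrA subrK.
rewrite add0r mulrDl mul1r; apply: le_trans (nrmD _ _) _; rewrite nrmN.
apply: lerD => //; apply: le_trans (nrm_opnorm _ ba) _.
by rewrite ler_wpM2l ?opnorm_ge0.
Qed.

End Commutants.

(** * Bounded operators on the interior tensor product *)

Section InteriorTensorProduct.
Local Open Scope complex_scope.
Context {R : realType} {K H G : hilbertType R} {E : lmodType R[i]}.
Variables (M : set (K -> K)) (act : E -> (K -> K) -> E).
Variables (ip : E -> E -> (K -> K)) (phi : (K -> K) -> (E -> E)).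
Variables (sigma : (K -> K) -> (H -> H)) (t : E -> H -> G).
Hypothesis wcE : wstar_correspondence M [set: E] act ip phi.
Hypothesis rep : normal_representation M sigma.
Hypothesis tensor : interior_tensor ip sigma t.

Lemma algebra_bounded a : M a -> bounded_op a.
Proof. by case: (wc_algebra wcE) => h _ _; exact: h. Qed.

Lemma algebra_adj a : M a -> M (adj a).
Proof. by case: (wc_algebra wcE) => _ h _; exact: h. Qed.

Lemma algebraZid (c : R[i]) : M (c *: id).
Proof.
have [_ _ <-] := wc_algebra wcE; apply: commutantZ => [S [] //|].
exact: commutant_id.
Qed.

Lemma algebra_id : M id.
Proof. by have := algebraZid 1; rewrite scale1r. Qed.

Lemma ip_in x y : M (ip x y).
Proof. exact: (hm_ip (wc_module wcE)). Qed.

Lemma repZ (c : R[i]) a : M a -> sigma (c *: a) = c *: sigma a.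
Proof.
move=> Ma; have M0 : M 0 by have := algebraZid 0; rewrite scale0r.
have s0 : sigma 0 = 0.
  have := rep_linear rep 1 M0 M0; rewrite !scale1r addr0 => h.
  by apply: (addrI (sigma 0)); rewrite addr0 -h.
by have := rep_linear rep c Ma M0; rewrite !addr0 s0 addr0.
Qed.

(** For a <= b the pair {a, b} is directed with supremum [b]; normality makes [sigma b] the supremum
    of the images, hence above [sigma a]. *)
Lemma rep_le a b : selfadjoint_part M a -> selfadjoint_part M b ->
  op_le a b -> op_le (sigma a) (sigma b).
Proof.
move=> sa sb ab.
have [] := @rep_normal _ _ _ _ _ rep [set a; b] b.
- by move=> _ [->|->].
- split; first by exists a; left.
  have bb : op_le b b by move=> x; exact: lexx.
  by move=> _ _ [->|->] [->|->]; exists b; split=> //; right.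
- split=> //; first by move=> _ [->|-> x] //; exact: lexx.
  by move=> u _; apply; right.
by move=> _ + _; apply; exists a => //; left.
Qed.

(** Monotonicity of [sigma], applied to <x, x> <= |<x, x>| 1, bounds |x (x) h|^2 = <h, sigma(<x, x>)
    h>. *)
Lemma nrm_tensor x h : nrm (t x h) <= module_norm ip x * nrm h.
Proof.
have bxx := algebra_bounded (ip_in x x).
have adjxx : adj (ip x x) = ip x x.
  by rewrite -(hm_ip_adj (wc_module wcE) (x := x) (y := x)).
pose n := opnorm (ip x x).
have n0 : 0 <= n by exact: opnorm_ge0.
rewrite -(@ler_pXn2r _ 2) ?nnegrE ?nrm_ge0 ?mulr_ge0 ?sqrtr_ge0 ?nrm_ge0 //.
rewrite exprMn sqr_sqrtr // -rdotxx /rdot (it_dot tensor).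
have sid : selfadj (n%:C *: (id : K -> K)).
  split; first by apply: boundedZ; exact: bounded_id.
  rewrite adj_scale; last exact: bounded_id.
  rewrite adj_id; congr (_ *: _); exact: conjc_real.
have : op_le (ip x x) (n%:C *: id).
  apply/op_leE => // k; rewrite fctE rdotZr rdotxx; exact: rdot_opnorm.
move=> /(rep_le (conj (ip_in x x) adjxx) (conj (algebraZid _) sid.2)) /(_ h).
rewrite repZ; last exact: algebra_id.
by rewrite (rep_unit rep) lecE => /andP[_]; rewrite fctE -!/(rdot _ _) rdotZr rdotxx.
Qed.

Lemma tensor_span_dense v :
  adherent [set \sum_(p <- s) t p.1 p.2 | s in [set: seq (E * H)]] v.
Proof.
move=> e e0.
have [||w [vw [s _ sw]]] := @it_dense _ _ _ _ _ _ _ _ tensor (ball v e%:C).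
- by exists v; apply: ballxx; rewrite ltcR.
- exact: ball_open.
exists (\sum_(p <- s) t p.1 p.2); split; first by exists s.
by move: vw; rewrite -sw -ball_normE /ball_ /= nrmE ltcR nrmB => /ltW.
Qed.

Lemma tensor_orth0 v : (forall x h, rdot v (t x h) = 0) -> v = 0.
Proof.
move=> h; apply: (adherent_orth0 (@tensor_span_dense v)).
by move=> _ [s _ <-]; rewrite rdot_sumr big1.
Qed.

Lemma tensor_ext (W : hilbertType R) (S T : G -> W) :
  bounded_op S -> bounded_op T -> (forall x h, S (t x h) = T (t x h)) -> S = T.
Proof.
move=> bS bT ST; rewrite -(adjK bS) -(adjK bT); congr adj; apply/funext => w.
apply/eqP; rewrite -subr_eq0; apply/eqP/tensor_orth0 => x h.
by rewrite rdotBl !rdot_adjl // ST subrr.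
Qed.

(** Expresses that the default value of [xget] is not taken. *)
Definition tensor_opP A B := bounded_op (tensor_op t A B) /\
  forall x h, tensor_op t A B (t x h) = t (A x) (B h).

Lemma tensor_op_spec A B T : bounded_op T ->
  (forall x h, T (t x h) = t (A x) (B h)) -> tensor_opP A B /\ tensor_op t A B = T.
Proof.
move=> bT TAB; have h : tensor_opP A B.
  by rewrite /tensor_opP /tensor_op; case: xgetP => // /(_ T) /(_ (conj bT TAB)).
by split=> //; apply: tensor_ext => // [|x k]; rewrite ?TAB ?h.2 //; exact: h.1.
Qed.

Lemma tensor_opE A B T : bounded_op T ->
  (forall x h, T (t x h) = t (A x) (B h)) -> tensor_op t A B = T.
Proof. by move=> bT /(tensor_op_spec bT) []. Qed.

(** Formal adjointness on elementary tensors, available before any boundedness is known. *)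
Definition tensor_adjoint A B A' B' := forall x h y k,
  hdot (t (A x) (B h)) (t y k) = hdot (t x h) (t (A' y) (B' k)).

Lemma tensor_adjoint_sym A B A' B' :
  tensor_adjoint A B A' B' -> tensor_adjoint A' B' A B.
Proof. by move=> ad x h y k; rewrite hdot_conj -ad -hdot_conj. Qed.

(** S = A'A (x) B'B is symmetric on sums of elementary tensors, where [m] and [r] control the growth
    of its orbits. Thus |S v| <= r |v| by [symmetric_orbit], and |(A (x) B) v|^2 = <v, S v> <= r
    |v|^2. This bound also makes A (x) B well defined on the span. *)
Lemma tensor_op_bounded A B A' B' (m : E -> H -> R) (r : R) :
  tensor_adjoint A B A' B' -> linear B -> 0 <= r ->
  (forall x h n, nrm (t (iter n (A' \o A) x) (iter n (B' \o B) h)) <= m x h * r ^+ n) ->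
  tensor_opP A B /\ forall v, nrm (tensor_op t A B v) <= Num.sqrt r * nrm v.
Proof.
move=> ad linB r0 growth.
pose sp n (s : seq (E * H)) :=
  \sum_(p <- s) t (iter n (A' \o A) p.1) (iter n (B' \o B) p.2).
pose spAB (s : seq (E * H)) := \sum_(p <- s) t (A p.1) (B p.2).
have spAB_sq s : nrm (spAB s) ^+ 2 = rdot (sp 0 s) (sp 1 s).
  rewrite -rdotxx !rdot_sumr; apply: eq_bigr => p _; rewrite !(rdotC (\sum_(_ <- _) _)).
  rewrite !rdot_sumr; apply: eq_bigr => q _ /=.
  by rewrite /rdot (tensor_adjoint_sym ad).
have sp_le s : nrm (sp 1 s) <= r * nrm (sp 0 s).
  apply: (@symmetric_orbit _ _ (fun n => sp n s) (\sum_(p <- s) m p.1 p.2)) => //.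
    move=> n n'; rewrite !rdot_sumr; apply: eq_bigr => p _.
    rewrite !(rdotC (\sum_(_ <- _) _)) !rdot_sumr; apply: eq_bigr => q _ /=.
    by rewrite /rdot -ad (tensor_adjoint_sym ad).
  move=> n; apply: le_trans (nrm_sum _ _) _; rewrite mulr_suml.
  by apply: ler_sum => p _; exact: growth.
have spAB_le s : nrm (spAB s) <= Num.sqrt r * nrm (\sum_(p <- s) t p.1 p.2).
  rewrite -(@ler_pXn2r _ 2) ?nnegrE ?nrm_ge0 ?mulr_ge0 ?sqrtr_ge0 ?nrm_ge0 //.
  rewrite exprMn sqr_sqrtr // spAB_sq; apply: le_trans (rdot_le _ _) _.
  by rewrite mulrC expr2 mulrA ler_wpM2r ?nrm_ge0 //; exact: sp_le.
pose L v w := exists2 s, v = \sum_(p <- s) t p.1 p.2 & w = spAB s.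
have linL : linear_relation L.
  split; first by exists [::]; rewrite /spAB ?big_nil.
  move=> c _ _ _ _ [s -> ->] [s' -> ->].
  (* Scalars are absorbed by the factor in [H]. *)
  exists ([seq (p.1, c *: p.2) | p <- s] ++ s');
    rewrite /spAB big_cat big_map scaler_sumr; congr (_ + _);
    apply: eq_bigr => p _ /=; rewrite ?(linZ linB) (linZ (it_linearr tensor _)) //.
have boundL v w : L v w -> nrm w <= Num.sqrt r * nrm v.
  by move=> [s -> ->]; exact: spAB_le.
(* [Y] is the adjoint of the relation, so [adj Y] is a bounded operator extending it. *)
have [Y bY [_ YL]] := relation_adjoint linL boundL.
have bY' := bounded_adj bY.
have YE s : adj Y (\sum_(p <- s) t p.1 p.2) = spAB s.
  apply: hdot_ext => z; rewrite hdot_adjl // hdot_conj.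
  by rewrite (YL z _ (spAB s)) -?hdot_conj //; exists s.
have [|spec ->] := @tensor_op_spec A B (adj Y) bY'.
  by move=> x h; have := YE [:: (x, h)]; rewrite /spAB !big_seq1.
(* The constant sqrt r, known on the dense span, passes to [v] by approximation. *)
split=> // v; apply: (@ler_epsM _ _ _ (opnorm (adj Y) + Num.sqrt r)) => [|e e0].
  by rewrite addr_ge0 ?opnorm_ge0 ?sqrtr_ge0.
have [_ [[s _ <-]]] := tensor_span_dense v e0; set w := \sum_(_ <- _) _ => vs.
have h1 : nrm (adj Y w) <= Num.sqrt r * nrm w by rewrite YE.
have h2 : Num.sqrt r * nrm w <= Num.sqrt r * (e + nrm v).
  rewrite ler_wpM2l ?sqrtr_ge0 // -{1}[w](subrK v); apply: le_trans (nrmD _ _) _.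
  by rewrite lerD2r.
have h3 : nrm (adj Y (v - w)) <= opnorm (adj Y) * e.
  apply: le_trans (nrm_opnorm _ bY') _.
  by rewrite ler_wpM2l ?opnorm_ge0 // nrmB.
have : nrm (adj Y v) <= nrm (adj Y (v - w)) + nrm (adj Y w).
  by rewrite -{1}[v](subrK w) (linD (bounded_lin bY')) nrmD.
by move: h1 h2 h3; rewrite mulrDr mulrDl; lra.
Qed.

Lemma adj_tensor_op A B A' B' : tensor_adjoint A B A' B' ->
  tensor_opP A B -> tensor_opP A' B' -> adj (tensor_op t A B) = tensor_op t A' B'.
Proof.
move=> ad [bT TE] [bT' TE']; apply: tensor_ext => // [|x h].
  exact: bounded_adj.
apply/eqP; rewrite -subr_eq0; apply/eqP/tensor_orth0 => y k.
by rewrite rdotBl rdot_adjl // TE TE' /rdot (tensor_adjoint_sym ad) subrr.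
Qed.

Lemma phi_tensor_adjoint a : M a -> tensor_adjoint (phi a) id (phi (adj a)) id.
Proof.
move=> Ma x h y k; rewrite !(it_dot tensor).
by rewrite (la_adj (wc_left wcE)).
Qed.

Lemma phi_bounded a : M a -> exists2 c, 0 <= c &
  forall x, module_norm ip (phi a x) <= c * module_norm ip x.
Proof.
move=> Ma; have [[_ _ _ [c hc]] _] := la_adjointable (wc_left wcE) Ma.
exists `|c| => // x; apply: le_trans (hc x I) _.
by rewrite ler_wpM2r ?sqrtr_ge0 ?ler_norm.
Qed.

(** Module bounds [c] for phi(a) and [c'] for phi(a^* ) give the growth rate c' c. *)
Lemma phi_tensor a : M a -> tensor_opP (phi a) id.
Proof.
move=> Ma; have [c c0 hc] := phi_bounded Ma.
have [c' c'0 hc'] := phi_bounded (algebra_adj Ma).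
have [] // := @tensor_op_bounded (phi a) id (phi (adj a)) id
  (fun x h => module_norm ip x * nrm h) (c' * c).
- exact: phi_tensor_adjoint.
- exact: mulr_ge0.
move=> x h n; have -> : iter n (id \o id) h = h by elim: n.
apply: le_trans (nrm_tensor _ _) _; rewrite mulrAC ler_wpM2r ?nrm_ge0 //.
elim: n => [|n IH]; first by rewrite mulr1.
rewrite exprS iterS mulrCA.
apply: (@le_trans _ _ (c' * c * module_norm ip (iter n (phi (adj a) \o phi a) x))).
  by rewrite -mulrA; apply: le_trans (hc' _) _; rewrite ler_wpM2l.
by rewrite ler_wpM2l ?mulr_ge0.
Qed.

Lemma adj_phi_tensor a : M a ->
  adj (tensor_op t (phi a) id) = tensor_op t (phi (adj a)) id.
Proof.
move=> Ma; apply: adj_tensor_op; first exact: phi_tensor_adjoint.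
  exact: phi_tensor.
by apply: phi_tensor; exact: algebra_adj.
Qed.

(** * Amplifications of operators in the commutant of the representation *)

Local Notation N := (commutant (sigma @` M)).
Local Notation J X := (tensor_op t id X).
Local Notation L a := (tensor_op t (phi a) id).

Lemma rep_image_bounded : sigma @` M `<=` bounded_op.
Proof. by move=> _ [a Ma <-]; exact: rep_bounded Ma. Qed.

Lemma rep_image_adj S : (sigma @` M) S -> (sigma @` M) (adj S).
Proof.
by move=> [a Ma <-]; exists (adj a); [exact: algebra_adj | exact: rep_adj Ma].
Qed.

Lemma N_adj X : N X -> N (adj X).
Proof. exact: (commutant_adj rep_image_bounded rep_image_adj). Qed.

Lemma N_rep X a h : N X -> M a -> X (sigma a h) = sigma a (X h).
Proof. by move=> NX Ma; apply: (commutantP _ NX); exists a. Qed.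

(** [adj X] also lies in the commutant, so it moves past sigma(<x, y>). *)
Lemma amp_adjoint X : N X -> tensor_adjoint id X id (adj X).
Proof.
move=> NX x h y k; rewrite !(it_dot tensor) -(hdot_adj _ _ NX.1).
by rewrite N_rep //; [exact: N_adj | exact: ip_in].
Qed.

(** The orbits of X^* X grow at rate c^2, and the square root returns [c]: amplification does not
    increase the norm. *)
Lemma amp_bounded X (c : R) : N X -> 0 <= c ->
  (forall h, nrm (X h) <= c * nrm h) ->
  tensor_opP id X /\ forall v, nrm (J X v) <= c * nrm v.
Proof.
move=> NX c0 Xc; have cE : c = Num.sqrt (c ^+ 2) by rewrite sqrtr_sqr ger0_norm.
rewrite cE.
apply: (@tensor_op_bounded id X id (adj X)
  (fun x h => module_norm ip x * nrm h)); rewrite ?sqr_ge0 //.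
- exact: amp_adjoint.
- exact: bounded_lin NX.1.
move=> x h n; have -> : iter n (id \o id) x = x by elim: n.
apply: le_trans (nrm_tensor _ _) _; rewrite -mulrA ler_wpM2l ?sqrtr_ge0 //.
elim: n => [|n IH]; first by rewrite mulr1.
rewrite exprS iterS mulrCA expr2 -mulrA.
apply: le_trans (nrm_adj NX.1 c0 Xc _) _; rewrite ler_wpM2l //.
by apply: le_trans (Xc _) _; rewrite ler_wpM2l.
Qed.

Lemma amp_spec X : N X -> tensor_opP id X.
Proof.
move=> NX; have [] // := @amp_bounded X (opnorm X) NX.
  exact: opnorm_ge0 NX.1.
by move=> h; exact: nrm_opnorm NX.1.
Qed.

Lemma bounded_amp X : N X -> bounded_op (J X).
Proof. by case/amp_spec. Qed.

Lemma amp_tensor X x h : N X -> J X (t x h) = t x (X h).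
Proof. by case/amp_spec => _ ->. Qed.

Lemma adj_amp X : N X -> adj (J X) = J (adj X).
Proof.
move=> NX; apply: adj_tensor_op; first exact: amp_adjoint.
  exact: amp_spec.
by apply: amp_spec; exact: N_adj.
Qed.

Lemma amp_id : J id = id.
Proof. by apply: tensor_opE => //; exact: bounded_id. Qed.

Lemma amp_comp X Y : N X -> N Y -> J (X \o Y) = J X \o J Y.
Proof.
move=> NX NY; apply: tensor_opE => [|x h /=]; last by rewrite !amp_tensor.
by apply: bounded_comp; exact: bounded_amp.
Qed.

Lemma amp_lincomb (c : R[i]) X Y : N X -> N Y -> J (c *: X + Y) = c *: J X + J Y.
Proof.
move=> NX NY; apply: tensor_opE => [|x h].
  by apply: bounded_lincomb; exact: bounded_amp.
by rewrite !fctE !amp_tensor // (it_linearr tensor).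
Qed.

Lemma ampB X Y : N X -> N Y -> J (X - Y) = J X - J Y.
Proof.
by move=> NX NY; rewrite -scaleN1r addrC amp_lincomb // scaleN1r addrC.
Qed.

Lemma amp_phi X a : N X -> M a -> J X \o L a = L a \o J X.
Proof.
move=> NX Ma; have [bL LE] := phi_tensor Ma; have bJ := bounded_amp NX.
apply: tensor_ext => [||x h /=]; [exact: bounded_comp.. | by rewrite LE !amp_tensor // LE].
Qed.

(** With |P| = 2c, [positive_sq] reads P^2 <= 2c P, which means |P - c| <= c. Amplification
    preserves this norm bound, and |J P - c| <= c gives J P >= 0. *)
Lemma amp_ge0 P : N P -> selfadj P -> (forall h, 0 <= rdot h (P h)) ->
  forall v, 0 <= rdot v (J P v).
Proof.
move=> NP sP P0 v; pose c := opnorm P / 2.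
have c0 : 0 <= c by rewrite divr_ge0 // opnorm_ge0 //; exact: NP.1.
have Nc : N (c%:C *: id).
  by apply: commutantZ; [exact: rep_image_bounded | exact: commutant_id].
have NPc : N (P - c%:C *: id) by apply: commutantB => //; exact: rep_image_bounded.
have [|_ /(_ v) h] := amp_bounded NPc c0.
  move=> h; rewrite -(@ler_pXn2r _ 2) ?nnegrE ?nrm_ge0 ?(mulr_ge0 c0) ?nrm_ge0 //.
  have := positive_sq h sP (opnorm_ge0 NP.1) P0 (fun x => rdot_opnorm x NP.1).
  rewrite -[nrm ((P - c%:C *: id) h)]/(nrm (P h - c%:C *: h)) exprMn -!rdotxx.
  rewrite !(rdotBl, rdotBr, rdotZl, rdotZr) (rdotC (P h) h).
  have -> : opnorm P = 2 * c by rewrite /c mulrC divfK ?pnatr_eq0.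
  by lra.
move: h; rewrite (ampB NP Nc).
have -> : J (c%:C *: id) = c%:C *: id.
  have := amp_lincomb c%:C (commutant_id _) (commutant0 rep_image_bounded).
  have -> : J 0 = 0.
    apply: tensor_opE => [|x h]; first exact: bounded0.
    by rewrite -[LHS]/(0 : G) (lin0 (it_linearr tensor _)).
  by rewrite !addr0 amp_id.
rewrite -[(_ - _) v]/(J P v - c%:C *: v) => h.
have h2 := rdot_norm_le v (J P v - c%:C *: v).
have h3 : nrm v * nrm (J P v - c%:C *: v) <= c * nrm v ^+ 2.
  by rewrite expr2 mulrCA ler_wpM2l ?nrm_ge0.
have := ler_norm (- rdot v (J P v - c%:C *: v)); rewrite normrN.
move: (le_trans h2 h3); rewrite rdotBr rdotZr rdotxx; lra.
Qed.

(** * The dual space of intertwiners and its completeness *)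

Local Notation X := (sigma_dual M phi sigma t).

Lemma dual_bounded T : X T -> bounded_op T.
Proof. by case. Qed.

Lemma bounded_phi_tensor a : M a -> bounded_op (L a).
Proof. by case/phi_tensor. Qed.

Lemma dual_rep T a h : X T -> M a -> T (sigma a h) = L a (T h).
Proof. by move=> [_ XT] Ma; have := congr1 (fun f => f h) (XT a Ma). Qed.

Lemma dualP T : bounded_op T ->
  (forall a h, M a -> T (sigma a h) = L a (T h)) -> X T.
Proof. by move=> bT h; split=> // a Ma; apply/funext => x /=; exact: h. Qed.

Lemma dual0 : X 0.
Proof.
apply: dualP => [|a h Ma]; first exact: bounded0.
by rewrite -[LHS]/(0 : G) (lin0 (bounded_lin (bounded_phi_tensor Ma))).
Qed.

Lemma dual_lincomb (c : R[i]) S T : X S -> X T -> X (c *: S + T).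
Proof.
move=> XS XT; apply: dualP => [|a h Ma].
  exact: bounded_lincomb (dual_bounded XS) (dual_bounded XT).
by rewrite !fctE !dual_rep // (bounded_lin (bounded_phi_tensor Ma)).
Qed.

Lemma dual_sum (I : Type) (s : seq I) (f : I -> H -> G) :
  (forall i, X (f i)) -> X (\sum_(i <- s) f i).
Proof.
move=> h; apply: big_ind => // [|S T XS XT]; first exact: dual0.
by have := dual_lincomb 1 XS XT; rewrite scale1r.
Qed.

Lemma dual_act T Y : X T -> N Y -> X (T \o Y).
Proof.
move=> XT NY; apply: dualP => [|a h Ma /=].
  exact: bounded_comp (dual_bounded XT) NY.1.
by rewrite N_rep // dual_rep.
Qed.

Lemma dual_amp Y T : N Y -> X T -> X (J Y \o T).
Proof.
move=> NY XT; apply: dualP => [|a h Ma /=].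
  exact: bounded_comp (bounded_amp NY) (dual_bounded XT).
rewrite dual_rep //; exact: (congr1 (fun f => f (T h)) (amp_phi NY Ma)).
Qed.

(** The adjoint of the intertwining relation for [adj a]. *)
Lemma adj_dual_rep T a v : X T -> M a -> adj T (L a v) = sigma a (adj T v).
Proof.
move=> XT Ma; have Ma' := algebra_adj Ma; have ba := algebra_bounded Ma.
have bT := dual_bounded XT; have bs := rep_bounded rep Ma'.
have := congr1 (fun f => adj f v) (XT.2 _ Ma').
rewrite (adj_comp bT bs) (adj_comp (bounded_phi_tensor Ma') bT).
rewrite adj_phi_tensor // (adjK ba) (rep_adj rep Ma) (adjK (rep_bounded rep Ma)).
by [].
Qed.

Lemma dual_ip S T : X S -> X T -> N (adj S \o T).
Proof.
move=> XS XT; split; first exact: bounded_comp (bounded_adj XS.1) XT.1.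
by move=> _ [a Ma <-]; apply/funext => h /=; rewrite dual_rep // adj_dual_rep.
Qed.

(** A Cauchy sequence converges at every vector, at a rate uniform on the unit ball; linearity,
    boundedness and the intertwining relation pass to the pointwise limit. *)
Lemma dual_complete (u : nat -> H -> G) : (forall n, X (u n)) ->
  (forall e : R, 0 < e -> exists n0 : nat, forall m n : nat,
     (n0 <= m)%N -> (n0 <= n)%N -> hnorm (u m - u n) < e) ->
  exists2 T, X T & forall e : R, 0 < e -> exists n0 : nat, forall n : nat,
     (n0 <= n)%N -> hnorm (u n - T) < e.
Proof.
move=> Xu cu; have bu n : bounded_op (u n) := dual_bounded (Xu n).
have cux x (e : R) : 0 < e -> exists n0 : nat, forall m n : nat,
    (n0 <= m)%N -> (n0 <= n)%N -> nrm (u m x - u n x) <= e.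
  move=> e0; have x1 : 0 < nrm x + 1 by rewrite ltr_wpDl ?nrm_ge0.
  have [n0 h] := cu _ (divr_gt0 e0 x1); exists n0 => m n hm hn.
  apply: le_trans (nrm_hnorm x (boundedB (bu m) (bu n))) _.
  have := ltW (h m n hm hn); rewrite ler_pdivlMr // => h'; apply: le_trans h'.
  by rewrite ler_wpM2l ?hnorm_ge0 // lerDl.
(* Terms whose whole tail stays within e / 2; two of them are compared through a later term. *)
pose B x (e : R) : set G := [set w | exists n0 : nat, w = u n0 x /\
  forall m, (n0 <= m)%N -> nrm (u m x - u n0 x) <= e / 2].
have /choice[T TP] : forall x, exists w, forall e y, 0 < e -> B x e y -> nrm (y - w) <= e.
  move=> x; apply: complete_nested.
  - move=> e e0; have [n0 h] := cux x (e / 2) (divr_gt0 e0 (ltr0n _ 2)).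
    by exists (u n0 x), n0; split=> // m hm; exact: h.
  - move=> e e' e0 ee' _ [n0 [-> h]]; exists n0; split=> // m hm.
    by apply: le_trans (h m hm) _; rewrite ler_pM2r ?invr_gt0.
  - move=> e _ _ e0 [n [-> h]] [n' [-> h']].
    rewrite -(subrKA (u (maxn n n') x)) [e]splitr.
    apply: le_trans (nrmD _ _) _; rewrite nrmB.
    by apply: lerD; [apply: h; exact: leq_maxl | apply: h'; exact: leq_maxr].
have lim x (e : R) : 0 < e -> exists n0 : nat, forall n : nat,
    (n0 <= n)%N -> nrm (u n x - T x) <= e.
  move=> e0; have [n0 h] := cux x (e / 2) (divr_gt0 e0 (ltr0n _ 2)).
  exists n0 => n hn; apply: TP => //; exists n; split=> // m hm.
  by apply: h => //; exact: leq_trans hm.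
have unif (e : R) (n0 : nat) : (forall m n : nat,
    (n0 <= m)%N -> (n0 <= n)%N -> hnorm (u m - u n) < e) ->
    forall n x, (n0 <= n)%N -> nrm (u n x - T x) <= e * nrm x.
  move=> h n x hn; apply: ler_eps => d d0; have [n1 h1] := lim x d d0.
  rewrite -(subrKA (u (maxn n0 n1) x)); apply: le_trans (nrmD _ _) _.
  apply: lerD; last by apply: h1; exact: leq_maxr.
  apply: le_trans (nrm_hnorm x (boundedB (bu n) (bu _))) _.
  by rewrite ler_wpM2r ?nrm_ge0 // ltW // h // leq_maxl.
have linT : linear T.
  move=> a x y; apply/eqP; rewrite -subr_eq0; apply/eqP/nrm_eq0/le_anti.
  rewrite nrm_ge0 andbT.
  have a0 := Re_norm_ge0 a.
  apply: (@ler_epsM _ _ _ (complex.Re `|a| + 2)) => [|e e0]; first exact: addr_ge0.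
  have [n1 h1] := lim x e e0; have [n2 h2] := lim y e e0.
  have [n3 h3] := lim (a *: x + y) e e0.
  pose n := maxn n1 (maxn n2 n3).
  have {}h1 : nrm (u n x - T x) <= e by apply: h1; exact: leq_maxl.
  have {}h2 : nrm (u n y - T y) <= e by apply: h2; rewrite /n; lia.
  have {}h3 : nrm (u n (a *: x + y) - T (a *: x + y)) <= e by apply: h3; rewrite /n; lia.
  have -> : T (a *: x + y) - (a *: T x + T y) =
      a *: (u n x - T x) + (u n y - T y) - (u n (a *: x + y) - T (a *: x + y)).
    rewrite (bounded_lin (bu n)) scalerBr.
    by rewrite [in RHS]addrACA -[in RHS]opprD opprB [RHS]addrC addrA subrK.
  apply: le_trans (nrmD _ _) _; rewrite nrmN.
  have h4 := nrmD (a *: (u n x - T x)) (u n y - T y).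
  have : complex.Re `|a| * nrm (u n x - T x) <= complex.Re `|a| * e by rewrite ler_wpM2l.
  by rewrite nrmZ in h4; lra.
have bT : bounded_op T.
  have [n0 h] := cu 1 ltr01.
  apply/bounded_opP; split=> //; exists (hnorm (u n0) + 1).
  split=> [|x]; first by rewrite addr_ge0 ?hnorm_ge0.
  rewrite -[T x](subrK (u n0 x)) mulrDl addrC; apply: le_trans (nrmD _ _) _.
  apply: lerD; first exact: nrm_hnorm.
  by rewrite nrmB; exact: unif h _ _ (leqnn _).
exists T; last first.
  move=> e e0; have e2 : 0 < e / 2 by rewrite divr_gt0.
  have [n0 h] := cu _ e2; exists n0 => n hn.
  apply: (@le_lt_trans _ _ (e / 2)); last by rewrite ltr_pdivrMr // ltr_pMr // ltr1n.
  apply: hnorm_le => [||x]; [exact: boundedB | exact: ltW | exact: unif h _ _ hn].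
apply: dualP => // a h Ma; have bL := bounded_phi_tensor Ma.
apply/eqP; rewrite -subr_eq0; apply/eqP/nrm_eq0/le_anti; rewrite nrm_ge0 andbT.
apply: (@ler_epsM _ _ _ (opnorm (L a) + 1)) => [|e e0]; first by rewrite addr_ge0 ?opnorm_ge0.
have [n1 h1] := lim (sigma a h) e e0; have [n2 h2] := lim h e e0.
pose n := maxn n1 n2.
have -> : T (sigma a h) - L a (T h) = L a (u n h - T h) - (u n (sigma a h) - T (sigma a h)).
  rewrite (linB (bounded_lin bL)) (dual_rep _ (Xu n)) //.
  by rewrite opprB [RHS]addrC addrA subrK.
rewrite add0r mulrDl mul1r; apply: le_trans (nrmD _ _) _; rewrite nrmN.
apply: lerD; last by apply: h1; exact: leq_maxl.
apply: le_trans (nrm_opnorm _ bL) _; rewrite ler_wpM2l ?opnorm_ge0 //.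
by apply: h2; exact: leq_maxr.
Qed.

(** * Self-duality: representation of bounded module functionals *)

Section SelfDual.
Variables (F : (H -> G) -> (H -> H)) (c : R).
Hypothesis F_in : forall T, X T -> N (F T).
Hypothesis F_lin : forall (z : R[i]) S T, X S -> X T ->
  F (z *: S + T) = z *: F S + F T.
Hypothesis F_act : forall T Y, X T -> N Y -> F (T \o Y) = F T \o Y.
Hypothesis F_bounded : forall T, X T -> opnorm (F T) <= c * hnorm T.

(** A family of pairs (T_i, h_i) encodes the vector sum T_i h_i. *)
Local Notation family := (seq ({T | X T} * H)).

Lemma functional_sum (I : Type) (s : seq I) (f : I -> H -> G) :
  (forall i, X (f i)) -> F (\sum_(i <- s) f i) = \sum_(i <- s) F (f i).
Proof.
move=> Xf; have F0 : F 0 = 0.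
  have := F_lin 1 dual0 dual0; rewrite !scale1r addr0 => h.
  by apply: (addrI (F 0)); rewrite addr0 -h.
elim: s => [|i s IH]; first by rewrite !big_nil.
rewrite !big_cons -IH; have := F_lin 1 (Xf i) (dual_sum s Xf).
by rewrite !scale1r.
Qed.

(** A regularized least-squares problem: A = d^2 + sum T_i T_i^* is coercive, [W] solves A W = sum
    T_i F(T_i)^* , and [Z T] is the scaled residual of F(T)^* against T^* W, defined for every [T]
    in the dual. *)
Lemma functional_approx (s : family) (d : R) : 0 < d ->
  exists W (Z : {T | X T} -> H -> H), [/\ X W, forall T, N (Z T),
    W = \sum_(p <- s) (sval p.1 \o Z p.1) &
    forall T, adj (F (sval T)) = (adj (sval T) \o W) + (d ^+ 2)%:C *: Z T].
Proof.
move=> d0; have e0 : 0 < d ^+ 2 by rewrite exprn_gt0.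
set e := d ^+ 2 in e0 *.
have bX (T : {T | X T}) : bounded_op (sval T) := dual_bounded (svalP T).
have bF (T : {T | X T}) : bounded_op (F (sval T)) := (F_in (svalP T)).1.
pose P : G -> G := \sum_(p <- s) (sval p.1 \o adj (sval p.1)).
have bTT (p : {T | X T} * H) : bounded_op (sval p.1 \o adj (sval p.1)).
  by apply: bounded_comp; [exact: bX | exact: bounded_adj].
have bP : bounded_op P by exact: bounded_sum.
have sP : adj P = P.
  rewrite adj_sum //; apply: eq_bigr => p _.
  by rewrite adj_comp ?adjK //; exact: bounded_adj.
pose A : G -> G := e%:C *: id + P.
have AE x : A x = e%:C *: x + P x by [].
have bA : bounded_op A by apply: bounded_lincomb => //; exact: bounded_id.
have sA : adj A = A.
  rewrite adj_lincomb //; last exact: bounded_id.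
  by rewrite adj_id sP; congr (_ *: _ + _); exact: conjc_real.
have Ae x : e * nrm x ^+ 2 <= rdot x (A x).
  rewrite AE rdotDr rdotZr rdotxx lerDl /P fct_sumE rdot_sumr.
  by apply: sumr_ge0 => p _ /=; rewrite -rdot_adjl // rdotxx sqr_ge0.
have [Y bY AY] := coercive_inverse bA sA e0 Ae.
pose Q : H -> G := \sum_(p <- s) (sval p.1 \o adj (F (sval p.1))).
have XQ : X Q.
  by apply: dual_sum => p; apply: dual_act; [exact: svalP | apply: N_adj; exact: F_in (svalP _)].
pose W := Y \o Q.
have AW h : A (W h) = Q h by rewrite -[RHS]/(id (Q h)) -AY.
have AL a v : M a -> A (L a v) = L a (A v).
  move=> Ma; have lL := bounded_lin (bounded_phi_tensor Ma).
  rewrite !AE (linD lL) (linZ lL) /P !fct_sumE (lin_sum lL); congr (_ + _).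
  by apply: eq_bigr => p _ /=; rewrite adj_dual_rep ?dual_rep //; exact: svalP.
have XW : X W.
  apply: dualP => [|a h Ma]; first by apply: bounded_comp => //; exact: XQ.1.
  apply/eqP; rewrite -subr_eq0; apply/eqP/nrm_eq0/le_anti; rewrite nrm_ge0 andbT.
  (* [A] is bounded below and commutes with [L a], so the intertwining relation of [W] is checked
     after applying [A], where it becomes that of [Q]. *)
  rewrite -(pmulr_rle0 _ e0); apply: le_trans (coercive_inj e0 Ae _) _.
  rewrite (linB (bounded_lin bA)) AL // !AW (dual_rep _ XQ) //.
  by rewrite subrr nrm0.
pose Z (T : {T | X T}) := (e^-1)%:C *: (adj (F (sval T)) - (adj (sval T) \o W)).
have ZE T : adj (F (sval T)) = (adj (sval T) \o W) + e%:C *: Z T.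
  by rewrite /Z scalerA -rmorphM /= divff ?gt_eqF // scale1r addrC subrK.
exists W, Z; split=> // [T|].
  apply: commutantZ; first exact: rep_image_bounded.
  apply: commutantB; first exact: rep_image_bounded.
    by apply: N_adj; exact: F_in (svalP T).
  by apply: dual_ip => //; exact: svalP.
apply/funext => h; rewrite fct_sumE.
(* From A W = Q: d^2 W = Q - P W = sum T_i (F(T_i)^* - T_i^* W). *)
have : e%:C *: W h = \sum_(p <- s) sval p.1 (e%:C *: Z p.1 h).
  have -> : e%:C *: W h = Q h - P (W h) by rewrite -AW AE addrK.
  rewrite /Q /P !fct_sumE -sumrB; apply: eq_bigr => p _ /=.
  rewrite -(linB (bounded_lin (bX _))) ZE; congr (sval p.1 _).
  by rewrite !fctE /= addrAC subrr add0r.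
move=> /(congr1 ( *:%R (e^-1)%:C)).
rewrite scalerA -rmorphM /= mulVf ?gt_eqF // scale1r => ->.
rewrite scaler_sumr; apply: eq_bigr => p _ /=.
rewrite (linZ (bounded_lin (bX _))) scalerA -rmorphM /= mulVf ?gt_eqF //.
by rewrite scale1r.
Qed.

(** With u = sum F(T_i) h_i and v = sum T_i h_i, the formula for F(T_i)^* gives |u|^2 = <W u, v> +
    d^2 sum <Z_i u, h_i>. The first term is at most |c| |u| |v|, and the second is of order [d]. *)
Lemma functional_family_bound (s : family) :
  nrm (\sum_(p <- s) F (sval p.1) p.2) <=
  `|c| * nrm (\sum_(p <- s) sval p.1 p.2).
Proof.
have bX (T : {T | X T}) : bounded_op (sval T) := dual_bounded (svalP T).
have bF (T : {T | X T}) : bounded_op (F (sval T)) := (F_in (svalP T)).1.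
set u := \sum_(p <- s) _; set v := \sum_(p <- s) _.
have [->|u0] := eqVneq (nrm u) 0; first by rewrite mulr_ge0 ?nrm_ge0.
have ugt : 0 < nrm u by rewrite lt_neqAle eq_sym u0 nrm_ge0.
rewrite -(ler_pM2l ugt) -expr2 -rdotxx.
apply: (@ler_epsM _ _ _ (`|c| * nrm u * \sum_(p <- s) nrm p.2)) => [|d d0].
  by rewrite !mulr_ge0 ?nrm_ge0 // sumr_ge0 // => p _; exact: nrm_ge0.
have [W [Z [XW NZ WE FE]]] := functional_approx s d0.
have bW := dual_bounded XW.
(* F(W) = sum F(T_i) Z_i by the module property; moving each F(T_i) to the left factor and
   substituting its adjoint produces both terms. *)
have FW k : rdot k (F W k) = nrm (W k) ^+ 2 + d ^+ 2 * \sum_(p <- s) nrm (Z p.1 k) ^+ 2.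
  rewrite {1}WE functional_sum; last first.
    by move=> p; apply: dual_act => //; exact: svalP.
  rewrite fct_sumE rdot_sumr -rdotxx {2}WE fct_sumE rdot_sumr mulr_sumr -big_split.
  apply: eq_bigr => p _ /=; rewrite F_act //; last exact: svalP.
  rewrite /= -rdot_adjl // FE rdotDl rdotZl rdotxx; congr (_ + _).
  by rewrite rdot_adjl.
pose w := hnorm W; have w0 : 0 <= w := hnorm_ge0 W.
have FWle k : rdot k (F W k) <= `|c| * w * nrm k ^+ 2.
  apply: le_trans (rdot_opnorm _ (F_in XW).1) _; rewrite ler_wpM2r ?sqr_ge0 //.
  by apply: le_trans (F_bounded XW) _; rewrite ler_wpM2r ?ler_norm.
have S0 k : 0 <= d ^+ 2 * \sum_(p <- s) nrm (Z p.1 k) ^+ 2.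
  by rewrite mulr_ge0 ?sqr_ge0 // sumr_ge0 // => p _; rewrite sqr_ge0.
(* |W k|^2 <= <k, F(W) k> <= |c| w |k|^2 gives w^2 <= |c| w. *)
have wc : w <= `|c|.
  have [->//|wn0] := eqVneq w 0.
  have wgt : 0 < w by rewrite lt_neqAle eq_sym wn0.
  rewrite -(ler_pM2r wgt) -expr2.
  have cw0 : 0 <= `|c| * w by rewrite mulr_ge0.
  rewrite -(sqr_sqrtr cw0) lerXn2r ?nnegrE ?sqrtr_ge0 //.
  apply: hnorm_le => // [|k]; first exact: sqrtr_ge0.
  rewrite -(@ler_pXn2r _ 2) ?nnegrE ?nrm_ge0 ?mulr_ge0 ?sqrtr_ge0 ?nrm_ge0 //.
  rewrite exprMn sqr_sqrtr //; apply: le_trans (FWle k).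
  by rewrite FW lerDl.
have {}FWle k : nrm (W k) ^+ 2 + d ^+ 2 * \sum_(p <- s) nrm (Z p.1 k) ^+ 2 <=
    (`|c| * nrm k) ^+ 2.
  rewrite -FW; apply: le_trans (FWle k) _.
  by rewrite exprMn ler_wpM2r ?sqr_ge0 // expr2 ler_wpM2l.
have Wle : nrm (W u) <= `|c| * nrm u.
  by apply: le_trans (nrm_hnorm _ bW) _; rewrite ler_wpM2r ?nrm_ge0.
have uE : rdot u u = rdot (W u) v + d ^+ 2 * \sum_(p <- s) rdot (Z p.1 u) p.2.
  rewrite {2}/u /v !rdot_sumr mulr_sumr -big_split; apply: eq_bigr => p _ /=.
  by rewrite -rdot_adjl // FE rdotDl rdotZl rdot_adjl.
(* By [FWle] each d |Z_i u| is at most |c| |u|; the other factor [d] remains. *)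
have Zle : d ^+ 2 * \sum_(p <- s) rdot (Z p.1 u) p.2 <=
    `|c| * nrm u * (\sum_(p <- s) nrm p.2) * d.
  have := @sum_mul_le _ _ s (fun p => d * nrm (Z p.1 u)) (fun p => nrm p.2)
    (`|c| * nrm u).
  move=> /(_ _ _ _ _) h; rewrite mulrC [leRHS]mulrC.
  apply: le_trans (_ : d * (\sum_(p <- s) d * nrm (Z p.1 u) * nrm p.2) <= _).
    rewrite mulrC expr2 -mulrA !mulr_sumr; apply: ler_sum => p _.
    rewrite ler_pM2l // -mulrA ler_pM2l //; exact: rdot_le.
  rewrite ler_pM2l //; apply: h => [|p|p|].
  - by rewrite mulr_ge0 ?nrm_ge0.
  - by rewrite mulr_ge0 ?nrm_ge0 ?(ltW d0).
  - exact: nrm_ge0.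
  under eq_bigr do rewrite exprMn.
  rewrite -mulr_sumr; apply: le_trans (FWle u).
  by rewrite lerDr sqr_ge0.
rewrite uE; apply: lerD => //; apply: le_trans (rdot_le _ _) _.
by rewrite mulrCA mulrA ler_wpM2r ?nrm_ge0.
Qed.

(** [y] is the adjoint of the relation sum T_i h_i |-> sum F(T_i) h_i. That its values lie in the
    closure of the domain is what makes it an intertwiner. *)
Lemma functional_represented :
  exists2 y, X y & forall T, X T -> F T = adj y \o T.
Proof.
pose D v w := exists2 s : family, v = \sum_(p <- s) sval p.1 p.2 &
  w = \sum_(p <- s) F (sval p.1) p.2.
have linD' : linear_relation D.
  split; first by exists [::]; rewrite !big_nil.
  move=> z _ _ _ _ [s -> ->] [s' -> ->].
  exists ([seq (p.1, z *: p.2) | p <- s] ++ s');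
    rewrite big_cat big_map scaler_sumr; congr (_ + _); apply: eq_bigr => p _ /=.
    by rewrite (linZ (bounded_lin (dual_bounded (svalP p.1)))).
  by rewrite (linZ (bounded_lin (F_in (svalP p.1)).1)).
have [|y by_ [ady yD]] := @relation_adjoint _ _ _ D `|c| linD'.
  by move=> _ _ [s -> ->]; exact: functional_family_bound.
have DT T h : X T -> D (T h) (F T h).
  by move=> XT; exists [:: (exist _ T XT, h)]; rewrite big_seq1.
exists y; last first.
  move=> T XT; apply/funext => h; apply: hdot_ext => k.
  by rewrite hdot_conj -(yD _ _ _ (DT T h XT)) -hdot_conj -hdot_adjl.
apply: dualP => // a k Ma; have bL := bounded_phi_tensor Ma; have lL := bounded_lin bL.
pose dom := [set v | exists w, D v w].
have domZD z v v' : dom v -> dom v' -> dom (z *: v + v').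
  by move=> [w Dvw] [w' Dvw']; exists (z *: w + w'); exact: linD'.2.
have domL v : dom v -> dom (L a v).
  move=> [_ [s -> _]]; exists (\sum_(p <- s) F (sval p.1) (sigma a p.2)).
  exists [seq (p.1, sigma a p.2) | p <- s]; last by rewrite big_map.
  rewrite big_map (lin_sum lL); apply: eq_bigr => p _ /=.
  by rewrite (dual_rep _ (svalP p.1)).
(* The difference is adherent to [dom], which [L a] preserves, and it is orthogonal to [dom], since
   each [F T] commutes with sigma(a^* ). *)
apply/eqP; rewrite -subr_eq0; apply/eqP; apply: (@adherent_orth0 _ _ dom).
  rewrite (_ : _ - _ = -1 *: L a (y k) + y (sigma a k)); last first.
    by rewrite scaleN1r [LHS]addrC.
  apply: (adherent_lin (domZD _)) => //.
  move=> e e0; have o1 : 0 < opnorm (L a) + 1 by rewrite ltr_wpDl ?opnorm_ge0.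
  have [v [dv vy]] := ady k _ (divr_gt0 e0 o1).
  exists (L a v); split; first exact: domL.
  rewrite -(linB lL); apply: le_trans (nrm_opnorm _ bL) _.
  apply: (@le_trans _ _ ((opnorm (L a) + 1) * nrm (v - y k))).
    by rewrite ler_wpM2r ?nrm_ge0 // lerDl.
  by rewrite mulrC -ler_pdivlMr.
move=> _ [_ [s -> _]]; rewrite rdot_sumr big1 // => p _.
have XT := svalP p.1; set T := sval p.1 in XT *.
have Ma' := algebra_adj Ma.
rewrite rdotBl /rdot (yD _ _ _ (DT T _ XT)) -(adjK bL) hdot_adjl; last exact: bounded_adj.
rewrite adj_phi_tensor // -(dual_rep _ XT) // (yD _ _ _ (DT T _ XT)).
rewrite (N_rep _ (F_in XT) Ma') (rep_adj rep Ma) hdot_adj ?subrr //.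
exact: rep_bounded Ma.
Qed.

End SelfDual.

(** * Strong continuity of amplification along bounded increasing nets *)

Lemma amp_strong_limit (D : set (H -> H)) s : D `<=` selfadjoint_part N ->
  directed_by op_le D -> selfadjoint_part N s -> (forall d, D d -> op_le d s) ->
  strong_limit D s ->
  forall v e, 0 < e -> eventually_in D (fun d => nrm (J d v - J s v) <= e).
Proof.
move=> DN Ddir [Ns ss] ubs lims v e e0; have [d0 Dd0] := Ddir.1.
have Dsa : D `<=` @selfadj R H by move=> d /DN [[bd _] sd].
have sas : selfadj s by split=> //; exact: Ns.1.
pose c := opnorm (s - d0).
have c0 : 0 <= c by apply: opnorm_ge0; exact: (selfadjB sas (Dsa _ Dd0)).1.
have JE d w : D d -> J d w - J s w = - J (s - d) w.
  by move=> Dd; rewrite (ampB Ns (DN _ Dd).1) -[(_ - _) w]/(J s w - J d w) opprB.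
have NB d : D d -> N (s - d).
  by move=> Dd; apply: commutantB; [exact: rep_image_bounded | exact: Ns | exact: (DN _ Dd).1].
(* Beyond [d0] one has 0 <= s - d <= s - d0, so [c] bounds the amplified differences uniformly. *)
have Jc d w : D d -> op_le d0 d -> nrm (J d w - J s w) <= c * nrm w.
  move=> Dd d0d; rewrite JE // nrmN.
  have [|_ -> //] := amp_bounded (NB d Dd) c0.
  move=> h; apply: positive_nrm => // [|{}h|{}h]; first exact: selfadjB (Dsa _ Dd).
    by rewrite rdotBr subr_ge0; exact: (iffLR (op_leE (Dsa _ Dd) sas) (ubs _ Dd)).
  apply: le_trans (rdot_opnorm h (selfadjB sas (Dsa _ Dd0)).1).
  by rewrite !rdotBr lerB //; exact: (iffLR (op_leE (Dsa _ Dd0) (Dsa _ Dd))).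
(* On sums of elementary tensors, convergence follows from that of [d h], one summand at a time. *)
have span (r : seq (E * H)) d' : 0 < d' -> eventually_in D (fun d =>
    nrm (J d (\sum_(p <- r) t p.1 p.2) - J s (\sum_(p <- r) t p.1 p.2)) <= d').
  elim: r d' => [|[x h] r IH] d' d'0.
    exists d0 => // d Dd _; rewrite big_nil !(lin0 (bounded_lin (bounded_amp _))) //.
      by rewrite subrr nrm0 ltW.
    exact: (DN _ Dd).1.
  have d2 : 0 < d' / 2 by rewrite divr_gt0.
  have m1 : 0 < module_norm ip x + 1 by rewrite ltr_wpDl ?sqrtr_ge0.
  have [d1 Dd1 P1] := eventually_inI Ddir (IH _ d2) (lims h _ (divr_gt0 d2 m1)).
  exists d1 => // d Dd /(P1 d Dd) [h1 h2]; rewrite big_cons /=.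
  rewrite (linD (bounded_lin (bounded_amp (DN _ Dd).1))).
  rewrite (linD (bounded_lin (bounded_amp Ns))) opprD addrACA [d']splitr.
  apply: le_trans (nrmD _ _) _; apply: lerD => //.
  rewrite !amp_tensor //; last exact: (DN _ Dd).1.
  rewrite -(linB (it_linearr tensor x)); apply: le_trans (nrm_tensor _ _) _.
  move: h2; rewrite ler_pdivlMr // => /(le_trans _); apply.
  by rewrite mulrC ler_wpM2l ?nrm_ge0 // lerDl.
(* An approximation of [v] within e / (2 (c + 1)) costs at most e / 2 under the uniform bound
   [c]. *)
have cK : 0 < 2 * (c + 1) by rewrite mulr_gt0 // ltr_wpDl.
have [_ [[r _ <-]]] := tensor_span_dense v (divr_gt0 e0 cK).
set w := \sum_(_ <- _) _ => wv.
have [d1 Dd1 P1] := eventually_inI Ddir (span r _ (divr_gt0 e0 (ltr0n _ 2)))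
  (eventually_in_ge Dd0).
exists d1 => // d Dd /(P1 d Dd) [h1 d0d].
have subE (p q a b : G) : a - b = (p - q) - ((p - a) - (q - b)).
  rewrite [p - a - _]addrC opprB [b - q]addrC -[_ + (p - a)]addrC addrACA.
  by rewrite opprD addrA subrr add0r opprD opprK.
have -> : J d v - J s v = (J d w - J s w) - (J d (w - v) - J s (w - v)).
  rewrite (linB (bounded_lin (bounded_amp (DN _ Dd).1))).
  rewrite (linB (bounded_lin (bounded_amp Ns))).
  exact: subE.
apply: le_trans (nrmD _ _) _; rewrite nrmN [e]splitr; apply: lerD => //.
apply: le_trans (Jc d _ Dd d0d) _.
move: wv; rewrite ler_pdivlMr // mulrCA => wv.
have := nrm_ge0 (w - v); lra.
Qed.

(** * The correspondence structure on the dual *)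

Local Notation dual_action := (fun (T : H -> G) (Y : H -> H) => T \o Y).
Local Notation dual_product := (fun T S : H -> G => adj T \o S).
Local Notation dual_left := (fun (Y : H -> H) (T : H -> G) => J Y \o T).

Lemma dual_hilbert_module : hilbert_module N X dual_action dual_product.
Proof.
split.
- exact: dual0.
- by move=> c S T; exact: dual_lincomb.
- by move=> T Y; exact: dual_act.
- by [].
- move=> c T Y Z XT NY NZ; apply/funext => h.
  by rewrite /= !fctE /= (bounded_lin (dual_bounded XT)).
- by [].
- by [].
- by move=> S T; exact: dual_ip.
- move=> c S T U XS XT XU; apply/funext => h.
  by rewrite /= !fctE /= (bounded_lin (bounded_adj (dual_bounded XS))).
- by [].
- move=> S T XS XT; have bS := dual_bounded XS; have bT := dual_bounded XT.
  by rewrite (adj_comp (bounded_adj bS) bT) (adjK bS).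
- move=> T XT; have bT := dual_bounded XT => x /=.
  by rewrite hdot_adj // hdot_norm exprn_ge0.
- move=> T XT TT; have bT := dual_bounded XT; apply/funext => x.
  have := rdot_adj_comp x bT; rewrite TT -[(0 : H -> H) x]/(0 : H) rdot0r => /esym/eqP.
  by rewrite sqrf_eq0 => /eqP /nrm_eq0.
- exact: dual_complete.
Qed.

Lemma dual_left_module_map Y : N Y ->
  bounded_module_map N X dual_action dual_product (dual_left Y).
Proof.
move=> NY; have bJ := bounded_amp NY; split.
- by move=> T; exact: dual_amp.
- move=> c S T XS XT; apply/funext => h.
  by rewrite /= !fctE /= (bounded_lin bJ).
- by [].
exists (opnorm (J Y)) => T XT; have bT := dual_bounded XT.
apply: hnorm_le => [||h /=]; first exact: bounded_comp.
  by rewrite mulr_ge0 ?opnorm_ge0 ?hnorm_ge0.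
apply: le_trans (nrm_opnorm _ bJ) _; rewrite -mulrA ler_wpM2l ?opnorm_ge0 //.
exact: nrm_hnorm.
Qed.

Lemma dual_left_adjoint Y : N Y ->
  adjoint_maps X dual_product (dual_left Y) (dual_left (adj Y)).
Proof.
move=> NY S T XS XT; rewrite (adj_comp (bounded_amp NY) (dual_bounded XS)).
by rewrite adj_amp.
Qed.

(** Upper bound: amplification preserves positivity. Least: a competing bound [U] need not be an
    amplification, so it is compared with [J d] at each vector T x, and [amp_strong_limit] passes to
    [J s]. *)
Lemma dual_left_normal : normal_map (selfadjoint_part N) op_le
  [set T | adjointable N X dual_action dual_product T /\
           adjoint_maps X dual_product T T]
  (adjointable_le X dual_product) dual_left.
Proof.
move=> D s DN Ddir lubs; have [[Ns ss] ubs _] := lubs.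
have lims : strong_limit D s.
  exact: (commutant_lub_strong_limit rep_image_bounded DN Ddir lubs).
have Dsa : D `<=` @selfadj R H by move=> d /DN [[bd _] sd].
have sas : selfadj s by split=> //; exact: Ns.1.
have sJ Y : N Y -> adj Y = Y -> selfadj (J Y).
  by move=> NY sY; split; [exact: bounded_amp | rewrite adj_amp // sY].
split.
- split; first split.
  + exact: dual_left_module_map.
  + by exists (dual_left (adj s)); [apply: dual_left_module_map; exact: N_adj
      | exact: dual_left_adjoint].
  + by have := dual_left_adjoint Ns; rewrite ss.
- move=> _ [d Dd <-] T XT x; have bT := dual_bounded XT.
  have [Nd sd] := DN _ Dd.
  have NB : N (s - d) by apply: commutantB => //; exact: rep_image_bounded.
  rewrite /= hdot_adj // -[X in hdot _ X]/((J s - J d) (T x)) -(ampB Ns Nd).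
  have sB : selfadj (s - d) := selfadjB sas (Dsa _ Dd).
  apply: (iffRL (positive_opE (sJ _ NB sB.2))) => v.
  apply: amp_ge0 => // h; rewrite rdotBr subr_ge0.
  exact: (iffLR (op_leE (Dsa _ Dd) sas) (ubs _ Dd)).
- move=> U [[mU _] _] ubU T XT x; have bT := dual_bounded XT.
  rewrite /= hdot_adj // -[X in hdot _ X]/(U T x - J s (T x)).
  have ge d : D d -> 0 <= hdot (T x) (U T x - J d (T x)).
    by move=> Dd; have := ubU _ (ex_intro2 _ _ d Dd erefl) T XT x; rewrite /= hdot_adj.
  have hB (z : G) : hdot (T x) (U T x - z) = hdot (T x) (U T x) - hdot (T x) z.
    by rewrite hdotDr -scaleN1r hdotZr mulN1r.
  have [d0 Dd0] := Ddir.1.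
  (* The order of [R[i]] requires equal imaginary parts; the form of [U] at T x is real because U -
     J d0 is positive and [J d0] is self-adjoint. *)
  have im0 : complex.Im (hdot (T x) (U T x)) = 0.
    have := ge d0 Dd0; rewrite hB lecE raddfB /= (selfadj_Im _ (sJ _ (DN _ Dd0).1 (DN _ Dd0).2)).
    by rewrite subr0 => /andP[/eqP ->].
  rewrite hB lecE raddfB /= im0 (selfadj_Im _ (sJ _ Ns ss)) subrr eqxx /=.
  rewrite raddfB subr_ge0 -!/(rdot _ _).
  apply: (@ler_epsM _ _ _ (nrm (T x))) => [|e e0]; first exact: nrm_ge0.
  have [d Dd h] := eventually_in_ex
    (amp_strong_limit DN Ddir (conj Ns ss) ubs lims (T x) e0).
  have : rdot (T x) (J d (T x)) <= rdot (T x) (U T x).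
    by have := ge d Dd; rewrite lecE => /andP[_]; rewrite -/(rdot _ _) rdotBr subr_ge0.
  have : rdot (T x) (J s (T x) - J d (T x)) <= nrm (T x) * e.
    by apply: le_trans (rdot_le _ _) _; rewrite nrmB ler_wpM2l ?nrm_ge0.
  by rewrite rdotBr; lra.
Qed.

Lemma dual_correspondence : wstar_correspondence N X dual_action dual_product dual_left.
Proof.
split.
- exact: (von_neumann_commutant rep_image_bounded rep_image_adj).
- exact: dual_hilbert_module.
- move=> F F_in F_lin F_act [c F_bounded].
  exact: (functional_represented F_in F_lin F_act F_bounded).
split.
- move=> Y NY; split; first exact: dual_left_module_map.
  exists (dual_left (adj Y)); last exact: dual_left_adjoint.
  by apply: dual_left_module_map; exact: N_adj.
- by move=> c Y Z T NY NZ XT; rewrite amp_lincomb.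
- by move=> Y Z T NY NZ XT; rewrite amp_comp.
- exact: dual_left_adjoint.
- by move=> T XT; rewrite amp_id.
- exact: dual_left_normal.
Qed.

End InteriorTensorProduct.

Theorem proposition3p2 (R : realType) (K H G : hilbertType R)
    (M : set (K -> K))
    (E : lmodType R[i])
    (act : E -> (K -> K) -> E)
    (ip : E -> E -> (K -> K))
    (phi : (K -> K) -> (E -> E))
    (sigma : (K -> K) -> (H -> H))
    (t : E -> H -> G) :
  wstar_correspondence M [set: E] act ip phi ->
  normal_representation M sigma ->
  interior_tensor ip sigma t ->
  wstar_correspondence (commutant (sigma @` M))
    (sigma_dual M phi sigma t)
    (fun (T : H -> G) (Y : H -> H) => T \o Y)
    (fun T S : H -> G => adj T \o S)
    (fun (X : H -> H) (T : H -> G) => tensor_op t id X \o T).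
Proof. exact: dual_correspondence. Qed.
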